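(* Let $p$ be an odd prime, $a\in\mathbb Z_p$ with $a\not\equiv 0,-1\pmod p$, and $a'=(a-\langle a\rangle_p)/p$. (1) If $2\mid\langle a\rangle_p$ and $\langle a\rangle_p=2n$, then $$S_p(a)\equiv \frac{\binom{(a-1)/2}{n}^2}{\binom{a/2}{n}^2}\Big(1-2a'(2^{p-1}-1)+a'(2a'+1)(2^{p-1}-1)^2\Big)$$ $$\equiv\binom{(p-1)/2}{n}^2\Big(1+p\big((2a'+2)H_{2n}-(2a'+1)H_n-2a'q_p(2)\big)+\frac{p^2}{2}\Big(2a'q_p(2)^2+\big((2a'+2)H_{2n}-(2a'+1)H_n-2a'q_p(2)\big)^2+\frac12(2a'^2-1)H_n^{(2)}+2(1-a'^2)H_{2n}^{(2)}\Big)\Big)\pmod{p^3}.$$ (2) If $2\nmid\langle a\rangle_p$, then $$S_p(a)\equiv\frac{4^{\langle a\rangle_p-1}\,a'(a'+1)p^2}{a^2\binom{\langle a\rangle_p-1}{(\langle a\rangle_p-1)/2}^2}\equiv\frac{a'(a'+1)p^2}{a^2\binom{(p-1)/2}{(\langle a\rangle_p-1)/2}^2}\pmod{p^3}.$$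
   Context: For a prime $p$, $\mathbb Z_p$ denotes the set of rational numbers whose denominator is not divisible by $p$, and congruences modulo powers of $p$ are between elements of $\mathbb Z_p$ (the difference divided by that power of $p$ lies in $\mathbb Z_p$). For $a\in\mathbb Z_p$, $\langle a\rangle_p\in\{0,1,\ldots,p-1\}$ is determined by $a\equiv\langle a\rangle_p\pmod p$. For rational $a$ and integer $k\ge0$, $\binom ak=a(a-1)\cdots(a-k+1)/k!$. Define $S_n(a)=\sum_{k=0}^{n-1}\binom ak\binom{-1-a}k\binom{2k}k\frac1{4^k}$ for $n\ge1$. Also $q_p(2)=(2^{p-1}-1)/p$, $H_n=\sum_{k=1}^n\frac1k$, $H_n^{(2)}=\sum_{k=1}^n\frac1{k^2}$, $H_0=H_0^{(2)}=0$. *)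

(* Defs.v *)
From HB Require Import structures.
From mathcomp Require Import all_boot all_order all_algebra.
From mathcomp Require Import ring.

Set Implicit Arguments.
Unset Strict Implicit.
Unset Printing Implicit Defensive.

Import Order.TTheory GRing.Theory Num.Theory.
Local Open Scope ring_scope.

(* The ring Z_p of rationals whose reduced denominator is not divisible by p. *)
Definition pint (p : nat) : {pred rat} :=
  [pred x : rat | ~~ (p %| `|denq x|)%N].

(* x = y (mod p^m), as a relation between elements of Z_p. *)
Definition pcong (p m : nat) (x y : rat) : bool :=
  [&& x \in pint p, y \in pint p & (x - y) / (p ^ m)%:R \in pint p].

(* <a>_p. The value is p when a is not in Z_p; lemma presP below shows that
   for a in Z_p this is the residue of a in {0, ..., p-1}. *)
Definition pres (p : nat) (a : rat) : nat :=
  find (fun r : nat => pcong p 1 a r%:R) (iota 0 p).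

Definition binq (a : rat) (k : nat) : rat :=
  (\prod_(i < k) (a - i%:R)) / (k`!)%:R.

Definition Ssum (n : nat) (a : rat) : rat :=
  \sum_(0 <= k < n) binq a k * binq (- 1 - a) k * ('C(2 * k, k))%:R / 4 ^+ k.

(* The Fermat quotient of 2. *)
Definition qp2 (p : nat) : rat := (2 ^+ p.-1 - 1) / p%:R.

(* Generalized harmonic numbers: H_n is [harm 1 n], H_n^(2) is [harm 2 n]. *)
Definition harm (m n : nat) : rat := \sum_(1 <= k < n.+1) (k%:R ^+ m)^-1.

Lemma pint_frac (p : nat) (x : rat) (u : int) (v : nat) :
  ~~ (p %| v)%N -> x * v%:R = u%:~R -> x \in pint p.
Proof.
move=> pv xv; rewrite inE; apply: contra pv => /dvdn_trans; apply.
have v0 : (denq x)%:~R != 0 :> rat by rewrite intr_eq0 denq_neq0.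
have /eqP : numq x * v%:Z = u * denq x.
  apply: (@intr_inj rat); rewrite !intrM -xv -[X in _ = X * _ * _]divq_num_den.
  by rewrite mulrAC divfK.
move=> /eqP E.
have : (denq x %| numq x * v%:Z)%Z by rewrite E dvdz_mull.
rewrite Gauss_dvdzr; first by [].
by rewrite /coprimez /gcdz gcdnC; have := coprime_num_den x; rewrite /coprime => /eqP ->.
Qed.

Lemma presP (p : nat) (a : rat) : prime p -> a \in pint p ->
  (pres p a < p)%N /\ pcong p 1 a (pres p a)%:R.
Proof.
move=> pp ap.
have pn (n : nat) : n%:R \in pint p.
  apply: (@pint_frac _ _ n%:Z 1%N); first by rewrite dvdn1 neq_ltn prime_gt1 ?orbT.
  by rewrite mulr1.
have p0 : p%:R != 0 :> rat by rewrite pnatr_eq0 -lt0n prime_gt0.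
have h : has (fun r : nat => pcong p 1 a r%:R) (iota 0 p).
  have /coprimezP [[s t] /= st] : coprimez p (denq a).
    by rewrite coprimezE absz_nat prime_coprime //; move: ap; rewrite inE.
  pose w := numq a * t.
  have w0 : 0 <= (w %% p)%Z by rewrite modz_ge0 // -lt0n prime_gt0.
  have wp : (w %% p)%Z < p by rewrite ltz_pmod // ltz_nat prime_gt0.
  apply/hasP; exists `|(w %% p)%Z|%N.
    by rewrite mem_iota /= add0n -ltz_nat gez0_abs.
  rewrite /pcong ap pn /= expn1.
  apply: (@pint_frac _ _ (numq a * s + (w %/ p)%Z * denq a) `|denq a|%N) => //.
  have v0 : (denq a)%:~R != 0 :> rat by rewrite intr_eq0 denq_neq0.
  rewrite !natr_absz !ger0_norm // ?denq_ge0 //.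
  have -> : (w %% p)%Z = w - (w %/ p)%Z * p by rewrite {2}(divz_eq w p) addrC addKr.
  have av : a * (denq a)%:~R = (numq a)%:~R by rewrite -[X in X * _]divq_num_den divfK.
  have st1 : s%:~R * p%:R + t%:~R * (denq a)%:~R = 1 :> rat.
    by rewrite pmulrn -!intrM -intrD st.
  apply: (mulIf p0); rewrite mulrAC divfK // mulrBl av /w.
  transitivity ((numq a)%:~R * (s%:~R * p%:R + t%:~R * (denq a)%:~R)
      - ((numq a * t)%:~R - (w %/ p)%Z%:~R * p%:R) * (denq a)%:~R : rat).
    by rewrite st1 mulr1 intrD rmorphN /= !intrM.
  by rewrite intrD !intrM /w; ring.
have lt : (pres p a < p)%N by move: h; rewrite has_find size_iota.
by split=> //; move: (nth_find 0%N h); rewrite -/(pres p a) nth_iota.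
Qed.

(* Main.v *)
Require Import Defs.
From HB Require Import structures.
From mathcomp Require Import all_boot all_order all_algebra.
From mathcomp Require Import ring zify.

(* Zeilberger's algorithm gives a^2 S_n(a) - (a-1)^2 S_n(a-2) as one hypergeometric
   term, which for n = p vanishes mod p^3 unless a = 0, 1 (mod p).  Hence S_p(a)
   reduces mod p^3 to S_p(p t) or S_p(1 + p t), with t = a', according to the
   parity of <a>_p; the recurrence also settles the second.  Mod p^3, S_p(p t) is
   a polynomial of degree 2 in t with constant term 1, determined by its values at
   t = 1 and t = -1; these are C(2p,p)^2 / 4^p and C(p-1,(p-1)/2)^2 / 4^(p-1),
   evaluated by the congruences of Wolstenholme and Morley. *)

Set Implicit Arguments.
Unset Strict Implicit.
Unset Printing Implicit Defensive.

Import Order.TTheory GRing.Theory Num.Theory.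
Local Open Scope ring_scope.

(** * The recurrence for S_n *)

(** The weight of index $p$ has denominator $p^2$, coming from $p!^2$. At $n=p$ the inhomogeneous
    term of the recurrence is therefore $p$ times an element of $\mathbb Z_p$ times
    $\prod_{i<p-1}(a+i)(a-1-i)$. The factors $a+i$ include a multiple of $p$ unless $a\equiv1$, the
    factors $a-1-i$ unless $a\equiv0$; this is what singles out the residues 0 and 1. At $a=1+pt$
    only one $p$ comes from the product, but $(a-1)^2=p^2t^2$, so all of $S_p(1+pt)$ carries $p^2$
    and the remaining data matter only mod $p$. That keeps $p=3$ accessible in (2), while in (1) the
    inequalities $0<2n<p-1$ force $p>3$. The coefficients of the polynomial in $t$ are sums of
    central binomial coefficients that are never evaluated themselves. Its values at $t=\pm1$ are
    reachable by two exact facts: $S_{p+1}(p)=0$, and the symmetry $a\mapsto-1-a$, which turns $-p$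
    into $p-1$. *)

Lemma fact_neq0 n : (n`!)%:R != 0 :> rat.
Proof. by rewrite pnatr_eq0 -lt0n fact_gt0. Qed.

Lemma central_bin n : ('C(2 * n, n))%:R = ((2 * n)`!)%:R / (n`!)%:R ^+ 2 :> rat.
Proof.
have := @bin_fact (2 * n) n (leq_pmull n (ltn0Sn 1)).
have -> : (2 * n - n = n)%N by rewrite mul2n -addnn addnK.
move=> <-; rewrite !natrM.
by field; rewrite fact_neq0.
Qed.

(** The part of the summand that does not depend on $a$; its sign comes from reversing the factors
    of $\binom{-1-a}k$. *)
Definition wt (k : nat) : rat :=
  (- 1) ^+ k * ('C(2 * k, k))%:R / (4 ^+ k * (k`!)%:R ^+ 2).

Lemma wtS k : wt k.+1 = - (2 * k%:R + 1) / (2 * (k%:R + 1) ^+ 3) * wt k.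
Proof.
rewrite /wt !central_bin (_ : 2 * k.+1 = (2 * k).+2)%N ?mulnS //.
rewrite !factS !natrM !(exprS _ k) -!natr1 natrM.
have h4 : 4 ^+ k != 0 :> rat by rewrite expf_neq0.
have hk : k%:R + 1 != 0 :> rat by rewrite natr1 pnatr_eq0.
by field; rewrite h4 fact_neq0 hk.
Qed.

(** Each factor is $a(a+1)-i(i+1)$, which makes the invariance under $a\mapsto-1-a$ visible. *)
Definition quadprod (k : nat) (a : rat) : rat :=
  \prod_(i < k) ((a - i%:R) * (a + 1 + i%:R)).

Lemma binq_quadprod a k :
  binq a k * binq (- 1 - a) k = (- 1) ^+ k * quadprod k a / (k`!)%:R ^+ 2.
Proof.
rewrite /binq /quadprod mulf_div -expr2; congr (_ / _).
elim: k => [|k IH]; first by rewrite !big_ord0 mulr1.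
rewrite !big_ord_recr /= mulrACA IH exprS; ring.
Qed.

Lemma SsumE n a : Ssum n a = \sum_(0 <= k < n) wt k * quadprod k a.
Proof.
apply: eq_bigr => k _; rewrite binq_quadprod /wt.
by field; rewrite fact_neq0 expf_neq0.
Qed.

Lemma Ssum_sym n a : Ssum n (- 1 - a) = Ssum n a.
Proof.
rewrite !SsumE; apply: eq_bigr => k _; congr (_ * _).
by apply: eq_bigr => i _; ring.
Qed.

(** The common factor of [quadprod k.+1 a] and [quadprod k.+1 (a - 2)]; dividing it out leaves a
    quadratic polynomial in $a$ on each side. *)
Definition shiftprod (k : nat) (a : rat) : rat :=
  \prod_(i < k) ((a + i%:R) * (a - 1 - i%:R)).

Lemma quadprod_shift k a :
  quadprod k.+1 a = shiftprod k a * ((a + k%:R) * (a + k%:R + 1)).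
Proof.
elim: k => [|k IH].
  by rewrite /quadprod /shiftprod ?big_ord_recr !big_ord0 /=; ring.
rewrite /quadprod big_ord_recr -/(quadprod _ _) /= IH /shiftprod.
by rewrite [in RHS]big_ord_recr /= -!natr1; ring.
Qed.

Lemma quadprod_shift2 k a :
  quadprod k.+1 (a - 2) = shiftprod k a * ((a - 1 - k%:R) * (a - 2 - k%:R)).
Proof.
elim: k => [|k IH].
  by rewrite /quadprod /shiftprod ?big_ord_recr !big_ord0 /=; ring.
rewrite /quadprod big_ord_recr -/(quadprod _ _) /= IH /shiftprod.
by rewrite [in RHS]big_ord_recr /= -!natr1; ring.
Qed.

(** The last term is the telescoped Zeilberger certificate. Once [wt] and [shiftprod] are factored
    out, the induction step is an identity of rational functions in $n$ and $a$. *)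
Lemma Ssum_rec n a :
  a ^+ 2 * Ssum n.+1 a = (a - 1) ^+ 2 * Ssum n.+1 (a - 2)
    - 2 * (2 * a - 1) * n.+1%:R ^+ 3 * wt n.+1 * shiftprod n a.
Proof.
rewrite !SsumE; elim: n => [|n IH].
  rewrite !big_nat1 wtS /wt /quadprod /shiftprod !big_ord0 muln0 bin0 fact0.
  by rewrite add0r expr1n; field.
rewrite !(@big_nat_recr _ _ _ n.+1 0) //= !mulrDr IH.
rewrite quadprod_shift quadprod_shift2 (wtS n.+1).
rewrite /shiftprod big_ord_recr /= -!natr1.
have hk : n%:R + 1 + 1 != 0 :> rat by rewrite !natr1 pnatr_eq0.
field.
by rewrite hk.
Qed.

(** The factors $x-i$ and $x+i$ are paired, leaving $x$ and $x+j+1$ alone. At $x=pt$ this isolates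
    one factor $p$, and the pairs depend on $t$ only through $p^2t^2$. *)
Lemma quadprod_sq j x :
  quadprod j.+1 x = x * (x + j.+1%:R) * \prod_(i < j) (x ^+ 2 - i.+1%:R ^+ 2).
Proof.
elim: j => [|j IH]; first by rewrite /quadprod big_ord_recr !big_ord0 /=; ring.
rewrite /quadprod big_ord_recr -/(quadprod _ _) /= IH [in RHS]big_ord_recr /=.
by rewrite -!natr1; ring.
Qed.

(** * Identities for factorials, harmonic sums and finite products *)

Lemma prod_scale n (c : rat) (F : 'I_n -> rat) :
  \prod_(i < n) (c * F i) = c ^+ n * \prod_(i < n) F i.
Proof. by rewrite big_split /= prodr_const card_ord. Qed.

Lemma natr_fact n : (n`!)%:R = \prod_(i < n) i.+1%:R :> rat.
Proof.
elim: n => [|n IH]; first by rewrite big_ord0.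
by rewrite factS big_ord_recr /= -IH natrM mulrC.
Qed.

Lemma natr_factD n m :
  ((n + m)`!)%:R = (n`!)%:R * \prod_(i < m) (n%:R + i.+1%:R) :> rat.
Proof.
elim: m => [|m IH]; first by rewrite big_ord0 addn0 mulr1.
by rewrite addnS factS big_ord_recr /= natrM IH -addnS natrD; ring.
Qed.

Lemma natr_fact_double n :
  ((2 * n)`!)%:R = \prod_(i < n) ((2 * i%:R + 1) * (2 * i.+1%:R)) :> rat.
Proof.
elim: n => [|n IH]; first by rewrite big_ord0 muln0.
rewrite mulnS !factS big_ord_recr /= -IH !natrM.
by rewrite -!natr1 natrM; ring.
Qed.

Lemma harm_ord e n : harm e n = \sum_(i < n) (i.+1%:R ^+ e)^-1.
Proof. by rewrite /harm big_add1 big_mkord. Qed.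

Lemma harmS e n : harm e n.+1 = harm e n + (n.+1%:R ^+ e)^-1.
Proof. by rewrite !harm_ord big_ord_recr. Qed.

Lemma harm_double e n : harm e (2 * n) =
  \sum_(i < n) ((2 * i%:R + 1) ^+ e)^-1 + (2 ^+ e)^-1 * harm e n.
Proof.
elim: n => [|n IH]; first by rewrite muln0 !harm_ord !big_ord0 mulr0 addr0.
rewrite mulnS !harmS IH big_ord_recr /= mulrDr -invfM -exprMn.
rewrite -!natr1 natrM (_ : 2 * n%:R + 1 + 1 = 2 * (n%:R + 1)); last by ring.
ring.
Qed.

Lemma big_rev_ord (op : SemiGroup.com_law rat) idx n (F : nat -> rat) :
  \big[op/idx]_(i < n) F i = \big[op/idx]_(i < n) F (n - i.+1)%N.
Proof. by rewrite (reindex_inj rev_ord_inj). Qed.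

Lemma harm_cat e n : harm e (2 * n) =
  harm e n + \sum_(i < n) ((2 * n%:R - i%:R) ^+ e)^-1.
Proof.
rewrite !harm_ord mul2n -addnn big_split_ord /=; congr (_ + _).
rewrite (@big_rev_ord _ _ n (fun i => ((n + i).+1%:R ^+ e)^-1)).
apply: eq_bigr => i _; congr (_ ^+ _)^-1.
by rewrite -natr1 natrD natrB // -natr1; ring.
Qed.

(** For $2n+1=p$ this reads the odd numbers below $p$ as $p$ minus the even ones, which turns odd
    products and sums into even ones modulo $p$. *)
Lemma odd_prod_rev n : \prod_(i < n) (2 * i%:R + 1) =
  \prod_(i < n) ((2 * n%:R + 1) - 2 * i.+1%:R) :> rat.
Proof.
rewrite (@big_rev_ord _ _ n (fun i => 2 * i%:R + 1)).
by apply: eq_bigr => i _; rewrite natrB //; ring.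
Qed.

Lemma odd_sum_rev e n : \sum_(i < n) ((2 * i%:R + 1) ^+ e)^-1 =
  \sum_(i < n) (((2 * n%:R + 1) - 2 * i.+1%:R) ^+ e)^-1 :> rat.
Proof.
rewrite (@big_rev_ord _ _ n (fun i => ((2 * i%:R + 1) ^+ e)^-1)).
by apply: eq_bigr => i _; rewrite natrB //; congr (_ ^+ _)^-1; ring.
Qed.

Lemma harm_rev e n : harm e n = \sum_(i < n) ((n.+1%:R - i.+1%:R) ^+ e)^-1.
Proof.
rewrite harm_ord (@big_rev_ord _ _ n (fun i => (i.+1%:R ^+ e)^-1)).
apply: eq_bigr => i _; congr (_ ^+ _)^-1.
by rewrite -natr1 natrB // -!natr1; ring.
Qed.

(** Taken downwards from $2n$, the numerators are $(2n+1)-(i+1)$; division by $-(i+1)$ gives factors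
    congruent to 1 when $2n+1=p$. *)
Lemma central_bin_sign n : ('C(2 * n, n))%:R =
  (- 1) ^+ n * \prod_(i < n) (1 + (2 * n + 1)%:R * (- i.+1%:R^-1)) :> rat.
Proof.
have -> : ('C(2 * n, n))%:R = (\prod_(i < n) (n%:R + i.+1%:R)) / (n`!)%:R :> rat.
  by rewrite central_bin mul2n -addnn natr_factD; field; rewrite fact_neq0.
rewrite (@big_rev_ord _ _ n (fun i => n%:R + i.+1%:R)) natr_fact -prodf_div -prod_scale.
apply: eq_bigr => i _.
have hi : i%:R + 1 != 0 :> rat by rewrite natr1 pnatr_eq0.
rewrite -[X in X / _]/(n%:R + (n - i.+1).+1%:R) !natrD -!natr1 natrB // -!natr1.
by field; rewrite hi.
Qed.

(** This is $(2n-1)!!/(2n)!!=\binom{2n}n/4^n$. *)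
Definition oddquot n : rat := \prod_(i < n) ((2 * i%:R + 1) / (2 * i.+1%:R)).

Lemma central_bin_oddquot n : ('C(2 * n, n))%:R = 4 ^+ n * oddquot n :> rat.
Proof.
rewrite /oddquot central_bin natr_fact_double natr_fact.
rewrite -prodrXl -prodf_div -prod_scale.
apply: eq_bigr => i _.
by field; rewrite addrC natr1 pnatr_eq0.
Qed.

Lemma central_bin_succ n : ('C(2 * n.+1, n.+1))%:R =
  2 * \prod_(i < n) (1 + n.+1%:R * (i.+1%:R)^-1) :> rat.
Proof.
have -> : ('C(2 * n.+1, n.+1))%:R =
    (\prod_(i < n.+1) (n.+1%:R + i.+1%:R)) / (n.+1`!)%:R :> rat.
  by rewrite central_bin mul2n -addnn natr_factD; field; rewrite fact_neq0.
have h i : i.+1%:R != 0 :> rat by rewrite pnatr_eq0.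
rewrite natr_fact -prodf_div big_ord_recr /= mulrC; congr (_ * _).
  by move: (n.+1%:R) (h n) => x hx; field; rewrite hx.
by apply: eq_bigr => i _; move: (i.+1%:R) (h i) => x hx; field; rewrite hx.
Qed.

Lemma binq_ratio a n : binq ((a - 1) / 2) n / binq (a / 2) n =
  \prod_(i < n) ((a - 1 - (2 * i)%:R) / (a - (2 * i)%:R)).
Proof.
rewrite /binq invf_div mulrA divfK ?fact_neq0 // -prodf_div.
apply: eq_bigr => i _; rewrite natrM.
have h (x : rat) : (x / 2 - i%:R) = (x - 2 * i%:R) / 2 by field.
by rewrite !h invf_div mulrA divfK.
Qed.

(** Reverses the product produced by $n$ steps $a\mapsto a-2$ from $a=2n+r+x$. It is used with $r=0$
    for even and $r=1$ for odd residues, and $x=pt$. *)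
Lemma descent_prod_rev n (r x : rat) :
  \prod_(i < n) (((2 * n)%:R + r + x - 1 - (2 * i)%:R)
                 / ((2 * n)%:R + r + x - (2 * i)%:R)) =
  \prod_(i < n) ((2 * i%:R + 1 + r + x) / (2 * i.+1%:R + r + x)).
Proof.
rewrite (@big_rev_ord _ _ n (fun i => ((2 * n)%:R + r + x - 1 - (2 * i)%:R)
  / ((2 * n)%:R + r + x - (2 * i)%:R))).
apply: eq_bigr => i _; rewrite !natrM natrB // -natr1.
by congr (_ / _); ring.
Qed.

Lemma odd_neq0 i : 2 * i%:R + 1 != 0 :> rat.
Proof. by rewrite -natrM natr1 pnatr_eq0. Qed.

Lemma even_neq0 i : 2 * i.+1%:R != 0 :> rat.
Proof. by rewrite -natrM pnatr_eq0. Qed.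

Lemma binq_half n (x : rat) : binq ((x - 1) / 2) n =
  (- 1) ^+ n * (oddquot n * \prod_(i < n) (1 + x * - (2 * i%:R + 1)^-1)).
Proof.
rewrite /binq natr_fact -prodf_div /oddquot -big_split -prod_scale /=.
apply: eq_bigr => i _; move: (odd_neq0 i) (even_neq0 i); move: (i.+1%:R) => y h1.
rewrite mulf_eq0 negb_or => /andP[_ h2].
by field; rewrite h1 h2.
Qed.

(** The numerators and denominators of the two products cancel telescopically. This evaluates the
    descent product for odd residues modulo $p$. *)
Lemma oddquot_shift n :
  \prod_(i < n) ((2 * i.+1%:R) / (2 * i.+1%:R + 1)) *
    ((2 * n%:R + 1) * oddquot n) = 1 :> rat.
Proof.
rewrite /oddquot; elim: n => [|n IH]; first by rewrite !big_ord0; ring.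
rewrite !big_ord_recr /= -[RHS]IH.
move: (odd_neq0 n) (even_neq0 n) (odd_neq0 n.+1); move: (n.+1%:R) => y h1 h2 h3.
move: h2; rewrite mulf_eq0 negb_or => /andP[_ h2].
by field; rewrite h2 h3.
Qed.

(** * Congruences modulo powers of p *)

Section OddPrime.
Variables (p : nat) (hp : prime p) (hodd : odd p).

Lemma pint_subring : subring_closed (pint p).
Proof.
have pM x y : x \in pint p -> y \in pint p -> ~~ (p %| `|denq x| * `|denq y|)%N.
  by rewrite !inE Euclid_dvdM // negb_or => -> ->.
have den x : x * (`|denq x|%N)%:R = (numq x)%:~R.
  by rewrite natr_absz normr_denq -[X in X * _]divq_num_den divfK // intr_eq0 denq_neq0.
split=> [|x y hx hy|x y hx hy].
- by rewrite inE /= dvdn1 neq_ltn prime_gt1 ?orbT.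
- pose u := numq x * `|denq y|%N - numq y * `|denq x|%N.
  apply: (@pint_frac _ _ u _ (pM _ _ hx hy)).
  by rewrite natrM intrB !intrM -!den -!pmulrn; ring.
- apply: (@pint_frac _ _ (numq x * numq y) _ (pM _ _ hx hy)).
  by rewrite natrM !intrM -!den; ring.
Qed.

HB.instance Definition _ := GRing.isSubringClosed.Build rat (pint p) pint_subring.

(** The units of $\mathbb Z_p$. The clause [x != 0] is there because the inverse of 0 is 0 by
    convention, so 0 would pass the other two tests. *)
Definition punit : {pred rat} :=
  [pred x | [&& x \in pint p, x^-1 \in pint p & x != 0]].

Lemma punit_pint x : x \in punit -> x \in pint p.
Proof. by case/and3P. Qed.

Lemma punitV_pint x : x \in punit -> x^-1 \in pint p.
Proof. by case/and3P. Qed.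

Lemma punit_neq0 x : x \in punit -> x != 0.
Proof. by case/and3P. Qed.

Lemma punitM x y : x \in punit -> y \in punit -> x * y \in punit.
Proof.
move=> /and3P[x1 x2 x3] /and3P[y1 y2 y3].
by rewrite inE rpredM //= invfM rpredM //= mulf_neq0.
Qed.

Lemma punitV x : x \in punit -> x^-1 \in punit.
Proof. by move=> /and3P[x1 x2 x3]; rewrite inE invrK x1 x2 invr_eq0. Qed.

Lemma punitN x : x \in punit -> - x \in punit.
Proof. by move=> /and3P[x1 x2 x3]; rewrite inE invrN !rpredN x1 x2 oppr_eq0. Qed.

Lemma punit1 : 1 \in punit.
Proof. by rewrite inE invr1 rpred1 oner_neq0. Qed.

Lemma punitX x n : x \in punit -> x ^+ n \in punit.
Proof.
by move=> hx; elim: n => [|n IH]; rewrite ?punit1 // exprS punitM.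
Qed.

Lemma punit_prod (I : Type) (s : seq I) (P : pred I) (F : I -> rat) :
  (forall i, P i -> F i \in punit) -> \prod_(i <- s | P i) F i \in punit.
Proof. by move=> h; elim/big_ind: _ => //; [exact: punit1|exact: punitM]. Qed.

Lemma p_neq0 : p%:R != 0 :> rat.
Proof. by rewrite pnatr_eq0 -lt0n prime_gt0. Qed.

Lemma pn_neq0 n : (p ^ n)%:R != 0 :> rat.
Proof. by rewrite natrX expf_neq0 // p_neq0. Qed.

Lemma punit_nat n : ~~ (p %| n)%N -> n%:R \in punit.
Proof.
move=> h; have n0 : n%:R != 0 :> rat.
  by rewrite pnatr_eq0; apply: contra h => /eqP ->; rewrite dvdn0.
rewrite inE n0 rpred_nat /= andbT.
by apply: (@pint_frac _ _ 1 n) => //; rewrite mulVf.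
Qed.

Lemma punit_small n : (0 < n < p)%N -> n%:R \in punit.
Proof.
by case/andP=> n0 np; apply: punit_nat; rewrite gtnNdvd.
Qed.

Lemma punit_fact n : (n < p)%N -> (n`!)%:R \in punit.
Proof.
elim: n => [|n IH] np; first by rewrite fact0 punit1.
by rewrite factS natrM; apply: punitM; [exact: punit_small|apply: IH; exact: ltnW].
Qed.

Lemma pcong_refl m x : x \in pint p -> pcong p m x x.
Proof. by move=> h; rewrite /pcong h subrr mul0r rpred0. Qed.

Lemma pcong_sym m x y : pcong p m x y -> pcong p m y x.
Proof. by case/and3P=> h1 h2 h3; rewrite /pcong h1 h2 -opprB mulNr rpredN. Qed.

Lemma pcong_trans m y x z : pcong p m x y -> pcong p m y z -> pcong p m x z.
Proof.
case/and3P=> h1 h2 h3 /and3P[h4 h5 h6]; rewrite /pcong h1 h5 /=.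
have -> : x - z = (x - y) + (y - z) by ring.
by rewrite mulrDl rpredD.
Qed.

Lemma pcong_l m x y : pcong p m x y -> x \in pint p.
Proof. by case/and3P. Qed.

Lemma pcong_r m x y : pcong p m x y -> y \in pint p.
Proof. by case/and3P. Qed.

Lemma pcongD m x y z t :
  pcong p m x y -> pcong p m z t -> pcong p m (x + z) (y + t).
Proof.
case/and3P=> h1 h2 h3 /and3P[h4 h5 h6]; rewrite /pcong !rpredD //=.
by rewrite opprD addrACA mulrDl rpredD.
Qed.

Lemma pcongN m x y : pcong p m x y -> pcong p m (- x) (- y).
Proof.
case/and3P=> h1 h2 h3; rewrite /pcong !rpredN h1 h2 /=.
by rewrite -opprD mulNr rpredN.
Qed.

Lemma pcongB m x y z t :
  pcong p m x y -> pcong p m z t -> pcong p m (x - z) (y - t).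
Proof. by move=> h1 h2; apply: pcongD => //; apply: pcongN. Qed.

Lemma pcongM m x y z t :
  pcong p m x y -> pcong p m z t -> pcong p m (x * z) (y * t).
Proof.
case/and3P=> h1 h2 h3 /and3P[h4 h5 h6]; rewrite /pcong (rpredM h1 h4) (rpredM h2 h5) /=.
have -> : (x * z - y * t) / (p ^ m)%:R =
  (x - y) / (p ^ m)%:R * z + y * ((z - t) / (p ^ m)%:R) by ring.
by rewrite rpredD // rpredM.
Qed.

Lemma pcongMl m c x y : c \in pint p -> pcong p m x y -> pcong p m (c * x) (c * y).
Proof. by move=> h; apply: pcongM; apply: pcong_refl. Qed.

Lemma pcongX m n x y : pcong p m x y -> pcong p m (x ^+ n) (y ^+ n).
Proof.
move=> h; elim: n => [|n IH]; first by rewrite !expr0 pcong_refl ?rpred1.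
by rewrite !exprS; apply: pcongM.
Qed.

Lemma pcong_sum m (I : Type) (s : seq I) (P : pred I) (F G : I -> rat) :
  (forall i, P i -> pcong p m (F i) (G i)) ->
  pcong p m (\sum_(i <- s | P i) F i) (\sum_(i <- s | P i) G i).
Proof.
move=> h; elim/big_ind2: _ => //; first by rewrite pcong_refl ?rpred0.
by move=> *; apply: pcongD.
Qed.

Lemma pcong_prod m (I : Type) (s : seq I) (P : pred I) (F G : I -> rat) :
  (forall i, P i -> pcong p m (F i) (G i)) ->
  pcong p m (\prod_(i <- s | P i) F i) (\prod_(i <- s | P i) G i).
Proof.
move=> h; elim/big_ind2: _ => //; first by rewrite pcong_refl ?rpred1.
by move=> *; apply: pcongM.
Qed.

Lemma pcongV m x y : x \in punit -> y \in punit ->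
  pcong p m x y -> pcong p m x^-1 y^-1.
Proof.
move=> hx hy h; have [x0 y0] := (punit_neq0 hx, punit_neq0 hy).
have hc : x^-1 * y^-1 \in pint p by rewrite rpredM ?punitV_pint.
have := pcongMl hc (pcong_sym h).
by rewrite mulfVK // mulrC mulVKf.
Qed.

Lemma pcong_le n m x y : (n <= m)%N -> pcong p m x y -> pcong p n x y.
Proof.
move=> nm /and3P[h1 h2 h3]; rewrite /pcong h1 h2 /=.
have -> : (x - y) / (p ^ n)%:R = (p ^ (m - n))%:R * ((x - y) / (p ^ m)%:R).
  rewrite -{2}(subnK nm) expnD natrM.
  by field; rewrite ?pn_neq0.
by rewrite rpredM // rpred_nat.
Qed.

Lemma pcong_shift n m x y :
  pcong p m x y -> pcong p (n + m) (p%:R ^+ n * x) (p%:R ^+ n * y).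
Proof.
have hn : p%:R ^+ n \in pint p by rewrite rpredX ?rpred_nat.
case/and3P=> h1 h2 h3; rewrite /pcong (rpredM hn h1) (rpredM hn h2) /=.
rewrite -mulrBr expnD natrM -natrX -mulf_div divff ?mul1r //.
exact: pn_neq0.
Qed.

Lemma pcong_add m x z : x \in pint p -> z \in pint p ->
  pcong p m (x + p%:R ^+ m * z) x.
Proof.
move=> hx hz; have hn : p%:R ^+ m * z \in pint p by rewrite rpredM ?rpredX ?rpred_nat.
rewrite /pcong hx (rpredD hx hn) /=.
have -> : x + p%:R ^+ m * z - x = z * (p ^ m)%:R by rewrite natrX; ring.
by rewrite mulfK ?pn_neq0.
Qed.

Lemma pcong_eq m x y z : y \in pint p -> z \in pint p ->
  x = y + p%:R ^+ m * z -> pcong p m x y.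
Proof. by move=> hy hz ->; apply: pcong_add. Qed.

Lemma pcongP m x y : pcong p m x y ->
  exists2 z, z \in pint p & x = y + p%:R ^+ m * z.
Proof.
case/and3P=> h1 h2 h3; exists ((x - y) / (p ^ m)%:R) => //.
by rewrite -natrX mulrC divfK ?pn_neq0 // addrC subrK.
Qed.

Lemma punit_ncong0 x : x \in pint p -> ~~ pcong p 1 x 0 -> x \in punit.
Proof.
move=> hx h.
have x0 : x != 0 by apply: contraNN h => /eqP ->; rewrite pcong_refl ?rpred0.
have dx : (denq x)%:~R != 0 :> rat by rewrite intr_eq0 denq_neq0.
have nx : (numq x)%:~R != 0 :> rat by rewrite intr_eq0 numq_eq0.
have pn : ~~ (p %| `|numq x|)%N.
  apply: contraNN h => pn.
  rewrite /pcong hx rpred0 subr0 expn1 /=.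
  apply: (@pint_frac _ _ (numq x %/ p)%Z `|denq x|%N) => //.
  rewrite natr_absz normr_denq -{1}(divq_num_den x).
  have -> : numq x = (numq x %/ p)%Z * p by rewrite divzK.
  rewrite intrM -pmulrn mulzK; last by rewrite -lt0n prime_gt0.
  by move: dx (_%:~R) => /divfK dx u; rewrite mulrAC dx mulfK ?p_neq0.
rewrite inE hx x0 andbT /=.
have xV : x^-1 * (numq x)%:~R = (denq x)%:~R.
  by rewrite -{1}(divq_num_den x) invf_div mulfVK.
(* [pint_frac] takes a natural number as denominator, so a negative sign of [numq x] has to move to
   the numerator of the inverse. *)
have [n0|n0] := ger0P (numq x).
  by apply: (@pint_frac _ _ (denq x) _ pn); rewrite natr_absz ger0_norm.
apply: (@pint_frac _ _ (- denq x) _ pn).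
by rewrite natr_absz ltr0_norm // !intrN mulrN xV.
Qed.

Lemma ncong0_small n : (0 < n < p)%N -> ~~ pcong p 1 n%:R 0.
Proof.
move=> hn; have := punit_small hn.
move=> /and3P[h1 h2 h3]; apply/negP => /pcongP[z hz].
rewrite add0r expr1 => e.
have : p%:R^-1 \in pint p.
  have -> : p%:R^-1 = z / n%:R.
    move: h3; rewrite e mulf_eq0 negb_or => /andP[p0 z0].
    by field; rewrite p0 z0.
  by rewrite rpredM.
rewrite inE.
by rewrite /= pmulrn denqVz ?normr_nat ?dvdnn // -lt0n prime_gt0.
Qed.

Lemma punit_cong x y : pcong p 1 x y -> y \in punit -> x \in punit.
Proof.
move=> h /and3P[y1 y2 y3]; apply: punit_ncong0; first exact: pcong_l h.
apply/negP => h0.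
have : pcong p 1 (y^-1 * y) (y^-1 * 0).
  by apply: pcongMl => //; apply: pcong_trans h0; apply: pcong_sym.
rewrite mulVf // mulr0; apply/negP; apply: (@ncong0_small 1).
exact: prime_gt1.
Qed.

Lemma pintN x : x \in pint p -> - x \in pint p.
Proof. by rewrite rpredN. Qed.

Ltac pint := try (lazymatch goal with
  | |- is_true (1 \in _) => exact: rpred1
  | |- is_true (0 \in _) => exact: rpred0
  | |- is_true (_%:R \in _) => exact: rpred_nat
  | H : is_true (?x \in _) |- is_true (?x \in _) => exact: H
  | |- is_true (?x + ?y \in _) => apply: rpredD; pint
  | |- is_true (- ?x \in _) => apply: pintN; pint
  | |- is_true (?x * ?y \in _) => apply: rpredM; pint
  | |- is_true (?x ^+ _ \in _) => apply: rpredX; pint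
  | |- is_true (?x^-1 \in _) => apply: punitV_pint; pint
  end).

(** * Truncated exponentials modulo $p^3$ *)

Lemma p_gt2 : (2 < p)%N.
Proof. by case: (even_prime hp) hodd => [->|] //; rewrite odd_prime_gt2. Qed.

Lemma punit2 : 2 \in punit.
Proof. by apply: (punit_small (n := 2)); rewrite p_gt2. Qed.

Lemma punit4 : 4 \in punit.
Proof. by rewrite (_ : 4 = 2 * 2) ?punitM ?punit2 //; ring. Qed.

(* [pexp x y] is exp (p x + p^2 y / 2) modulo p^3, so that products of
   units congruent to 1 become sums. *)
Definition pexp (x y : rat) : rat := 1 + p%:R * x + p%:R ^+ 2 * ((x ^+ 2 + y) / 2).

Lemma pexp_pint x y : x \in pint p -> y \in pint p -> pexp x y \in pint p.
Proof. by have h2 := punit2; rewrite /pexp => hx hy; pint. Qed.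

Lemma pexp0 : pexp 0 0 = 1.
Proof. by rewrite /pexp; ring. Qed.

(** The second argument comes from $\log(1+pc)\equiv pc-p^2c^2/2$. *)
Lemma pexp_lin c : 1 + p%:R * c = pexp c (- c ^+ 2).
Proof. by rewrite /pexp; ring. Qed.

Lemma pexpM x1 y1 x2 y2 : x1 \in pint p -> y1 \in pint p ->
  x2 \in pint p -> y2 \in pint p ->
  pcong p 3 (pexp x1 y1 * pexp x2 y2) (pexp (x1 + x2) (y1 + y2)).
Proof.
move=> hx1 hy1 hx2 hy2; have h2 := punit2.
have hu1 : (x1 ^+ 2 + y1) / 2 \in pint p by pint.
have hu2 : (x2 ^+ 2 + y2) / 2 \in pint p by pint.
(* The terms of order $p^2$ agree, since the cross term $x_1x_2$ completes the square of $x_1+x_2$;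
   the witness collects the orders $p^3$ and $p^4$. *)
apply: (pcong_eq (z := x1 * ((x2 ^+ 2 + y2) / 2) + x2 * ((x1 ^+ 2 + y1) / 2)
  + p%:R * ((x1 ^+ 2 + y1) / 2 * ((x2 ^+ 2 + y2) / 2)))).
- by apply: pexp_pint; pint.
- by pint.
by rewrite /pexp; field.
Qed.

Lemma pexp_cong x1 y1 x2 y2 : pcong p 2 x1 x2 -> pcong p 1 y1 y2 ->
  pcong p 3 (pexp x1 y1) (pexp x2 y2).
Proof.
move=> hx hy; apply: pcongD => //.
  apply: pcongD => //; first by rewrite pcong_refl ?rpred1.
  exact: (@pcong_shift 1 2).
apply: (@pcong_shift 2 1).
rewrite mulrC [X in pcong _ _ _ X]mulrC; apply: pcongMl => //.
  exact: punitV_pint punit2.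
apply: pcongD => //; apply: pcongX => //; exact: pcong_le hx.
Qed.

Lemma pexp_prod (n : nat) (c : nat -> rat) : (forall i, (i < n)%N -> c i \in pint p) ->
  pcong p 3 (\prod_(i < n) (1 + p%:R * c i))
    (pexp (\sum_(i < n) c i) (- \sum_(i < n) c i ^+ 2)).
Proof.
move=> hc; have hS i : (i <= n)%N ->
    (\sum_(j < i) c j \in pint p) && (\sum_(j < i) c j ^+ 2 \in pint p).
  move=> hi; apply/andP; split; apply: rpred_sum => j _; last apply: rpredX;
  by apply: hc; apply: leq_trans (ltn_ord j) hi.
elim: n hc hS => [|n IH] hc hS.
  by rewrite !big_ord0 oppr0 pexp0 pcong_refl ?rpred1.
have /andP[h1 h2] := hS n (leqnSn n); have hn := hc n (ltnSn n).
have hI := IH (fun i hi => hc i (ltnW hi)) (fun i hi => hS i (leqW hi)).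
rewrite !big_ord_recr /= opprD pexp_lin.
apply: pcong_trans (pexpM _ _ _ _) => //; try by pint.
apply: pcongM => //; apply: pcong_refl => //.
by apply: pexp_pint; pint.
Qed.

Lemma punit_pexp x y : x \in pint p -> y \in pint p -> pexp x y \in punit.
Proof.
move=> hx hy; apply: (punit_cong) punit1.
have h2 := punit2.
apply: (pcong_eq (z := x + p%:R * ((x ^+ 2 + y) / 2))); try by pint.
by rewrite /pexp; ring.
Qed.

Lemma pexpV x y : x \in pint p -> y \in pint p ->
  pcong p 3 (pexp x y)^-1 (pexp (- x) (- y)).
Proof.
move=> hx hy; have hu := punit_pexp hx hy.
have hx' : - x \in pint p by pint.
have hy' : - y \in pint p by pint.
have := pcongMl (punitV_pint hu) (pexpM hx hy hx' hy').
rewrite !subrr pexp0 mulr1 mulKf ?punit_neq0 //; exact: pcong_sym.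
Qed.

(** * Descent of $S_p$ along the recurrence *)

Lemma pcong_prod0 n (F : nat -> rat) i0 : (i0 < n)%N ->
  (forall i, (i < n)%N -> F i \in pint p) -> pcong p 1 (F i0) 0 ->
  pcong p 1 (\prod_(i < n) F i) 0.
Proof.
move=> hi hF h0; rewrite (bigD1 (Ordinal hi)) //= -[X in pcong _ _ _ X](mul0r
  (\prod_(i < n | i != Ordinal hi) F i)).
by apply: pcongM => //; apply: pcong_refl => //; apply: rpred_prod => i _; apply: hF.
Qed.

(** The factors $a+(p-r)$ and $a-1-(r-1)$ are multiples of $p$, and both indices are at most $p-2$
    because $2\le r\le p-1$. *)
Lemma shiftprod_cong0 a r : pcong p 1 a r%:R -> (1 < r < p)%N ->
  exists2 z, z \in pint p & shiftprod p.-1 a = p%:R ^+ 2 * z.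
Proof.
move=> ha /andP[r1 rp]; have hpa := pcong_l ha.
have h1 : pcong p 1 (\prod_(i < p.-1) (a + i%:R)) 0.
  apply: (@pcong_prod0 _ (fun i => a + i%:R) (p - r)); first by lia.
    by move=> i _; pint.
  apply: (@pcong_trans _ (r%:R + (p - r)%:R)).
    by apply: pcongD => //; apply: pcong_refl => //; pint.
  rewrite natrB 1?ltnW // addrC subrK.
  by apply: (pcong_eq (z := 1)); rewrite ?rpred0 ?rpred1 //; ring.
have h2 : pcong p 1 (\prod_(i < p.-1) (a - 1 - i%:R)) 0.
  apply: (@pcong_prod0 _ (fun i => a - 1 - i%:R) (r.-1)); first by lia.
    by move=> i _; pint.
  have -> : a - 1 - r.-1%:R = a - r%:R.
    by rewrite -[in RHS](@prednK r) -?natr1; [ring|lia].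
  rewrite -(subrr r%:R); apply: pcongB => //; apply: pcong_refl => //; pint.
have [z1 hz1 e1] := pcongP h1; have [z2 hz2 e2] := pcongP h2.
exists (z1 * z2); first by pint.
by rewrite /shiftprod big_split /= e1 e2; ring.
Qed.

Lemma punit_pred_fact : ((p.-1)`!)%:R \in punit.
Proof. by apply: punit_fact => //; rewrite prednK ?prime_gt0. Qed.

(** Clears the two factors $p$ of $p!^2$, leaving the denominator prime to $p$. *)
Lemma wt_p : p%:R ^+ 2 * wt p =
  (- 1) ^+ p * ('C(2 * p, p))%:R / (4 ^+ p * ((p.-1)`!)%:R ^+ 2).
Proof.
rewrite /wt -[in (p`!)%:R](prednK (prime_gt0 hp)) factS prednK ?prime_gt0 // natrM.
by field; rewrite p_neq0 fact_neq0 expf_neq0.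
Qed.

Lemma wt_p_pint : p%:R ^+ 2 * wt p \in pint p.
Proof.
rewrite wt_p; have h4 := punitX p punit4; have hf := punitX 2 punit_pred_fact.
by apply: rpredM; [by pint|apply: punitV_pint; apply: punitM].
Qed.

Lemma quadprod_pint k a : a \in pint p -> quadprod k a \in pint p.
Proof. by move=> ha; apply: rpred_prod => i _; pint. Qed.

Lemma wt_pint k : (k < p)%N -> wt k \in pint p.
Proof.
move=> hk; apply: rpredM; first by pint.
apply: punitV_pint; apply: punitM => //; apply: punitX => //.
  exact: punit4.
exact: punit_fact.
Qed.

Lemma Ssum_pint a : a \in pint p -> Ssum p a \in pint p.
Proof.
move=> ha; rewrite SsumE big_mkord rpred_sum // => i _.
by rewrite rpredM ?wt_pint ?quadprod_pint.
Qed.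

Lemma Ssum_step a r : pcong p 1 a r%:R -> (1 < r < p)%N ->
  pcong p 3 (Ssum p a) (((a - 1) / a) ^+ 2 * Ssum p (a - 2)).
Proof.
move=> ha hr; have hpa := pcong_l ha.
have hu : a \in punit by apply: (punit_cong ha); apply: punit_small => //; lia.
have [z hz e] := shiftprod_cong0 ha hr.
have := @Ssum_rec p.-1 a; rewrite prednK ?prime_gt0 // e => E.
have hw := wt_p_pint; have hS : Ssum p (a - 2) \in pint p by apply: Ssum_pint; pint.
have hv := punitV_pint hu; have h0 := punit_neq0 hu.
(* Of the factor $p^3w_p$ of the recurrence, $p^2w_p$ is in $\mathbb Z_p$ and one $p$ remains;
   [shiftprod] supplies the other two. *)
apply: (pcong_eq (z := - (2 * (2 * a - 1) * (p%:R ^+ 2 * wt p) * z * a^-1 ^+ 2))).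
- by pint.
- by pint.
apply: (mulfI (expf_neq0 2 h0)); rewrite E; field.
by rewrite h0.
Qed.

(** The bound [2 * n <= r] keeps the residue at least 2 before each of the $n$ steps, as [Ssum_step]
    demands. *)
Lemma Ssum_descent n a r : pcong p 1 a r%:R -> (2 * n <= r < p)%N ->
  pcong p 3 (Ssum p a)
    ((\prod_(i < n) ((a - 1 - (2 * i)%:R) / (a - (2 * i)%:R))) ^+ 2
      * Ssum p (a - (2 * n)%:R)).
Proof.
elim: n a r => [|n IH] a r ha hr.
  by rewrite big_ord0 expr1n mul1r muln0 subr0 pcong_refl // Ssum_pint ?(pcong_l ha).
have hr1 : (1 < r < p)%N by lia.
apply: (pcong_trans (Ssum_step ha hr1)).
have ha2 : pcong p 1 (a - 2) (r - 2)%:R.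
  rewrite natrB; last by lia.
  by apply: pcongB => //; apply: pcong_refl; rewrite ?rpred_nat.
have h : (2 * n <= r - 2 < p)%N by lia.
have {ha2 h}:= IH _ _ ha2 h.
have -> : a - (2 * n.+1)%:R = a - 2 - (2 * n)%:R by rewrite mulnS natrD; ring.
rewrite big_ord_recl /= muln0 mulr0n !subr0.
have -> : \prod_(i < n) ((a - 1 - (2 * bump 0 i)%:R) / (a - (2 * bump 0 i)%:R)) =
   \prod_(i < n) ((a - 2 - 1 - (2 * i)%:R) / (a - 2 - (2 * i)%:R)).
  apply: eq_bigr => i _; rewrite /bump mulnDr muln1 natrD.
  by congr (_ / _); ring.
have : (a - 1) / a \in pint p.
  have hu : a \in punit by apply: (punit_cong ha); apply: punit_small => //; lia.
  by have := pcong_l ha => ?; pint.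
move: (\prod_(i < n) _) (_ / _) (Ssum p (a - 2)) (Ssum p _) => P c S S' hc.
move/(pcongMl (rpredX 2 hc)); rewrite (mulrA (c ^+ 2)) -exprMn; exact.
Qed.

(** * The value at multiples of p *)

(** Up to sign and powers of $p$, these are for $e=1,2$ the coefficients of $t$ and $t^2$ in
    $S_p(pt)$ modulo $p^3$. *)
Definition bsum e : rat :=
  \sum_(i < p.-1) ('C(2 * i.+1, i.+1))%:R / (4 ^+ i.+1 * i.+1%:R ^+ e).

Lemma succ_punit i : (i < p.-1)%N -> i.+1%:R \in punit.
Proof. by move=> hi; apply: punit_small; have := prime_gt0 hp; lia. Qed.

Lemma bsum_pint e : bsum e \in pint p.
Proof.
rewrite rpred_sum // => i _; have h4 := punitX i.+1 punit4.
have hi := punitX e (succ_punit (ltn_ord i)).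
by apply: rpredM; [pint|apply: punitV_pint; apply: punitM].
Qed.

Lemma Ssum_split x :
  Ssum p x = 1 + \sum_(i < p.-1) wt i.+1 * quadprod i.+1 x.
Proof.
rewrite SsumE (big_ltn (prime_gt0 hp)) -[in \sum_(1 <= k < p) _](prednK (prime_gt0 hp)).
rewrite big_add1 big_mkord; congr (_ + _).
by rewrite /wt /quadprod big_ord0 muln0 bin0 fact0 !expr0; field.
Qed.

(** By [quadprod_sq] each term carries a factor $p$, so its other factors matter only mod $p^2$,
    where $p^2t^2-i^2\equiv-i^2$. *)
Lemma Ssum_mulp t : t \in pint p ->
  pcong p 3 (Ssum p (p%:R * t))
    (1 - t * (p%:R * bsum 1) - t ^+ 2 * (p%:R ^+ 2 * bsum 2)).
Proof.
move=> ht; rewrite Ssum_split.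
have -> : 1 - t * (p%:R * bsum 1) - t ^+ 2 * (p%:R ^+ 2 * bsum 2) =
  1 + \sum_(i < p.-1) wt i.+1 * (p%:R ^+ 1 *
    (t * (p%:R * t + i.+1%:R) * \prod_(j < i) ((-1) * (j.+1%:R * j.+1%:R)))).
  rewrite -addrA -opprD; congr (_ + _).
  rewrite /bsum !mulr_sumr -big_split -sumrN; apply: eq_bigr => i _ /=.
  rewrite /wt prod_scale big_split /= -natr_fact factS natrM (exprS (-1)).
  have h4 : 4 ^+ i.+1 != 0 :> rat by rewrite expf_neq0.
  have hi : i.+1%:R != 0 :> rat by rewrite pnatr_eq0.
  have s : (-1) ^+ i * (-1) ^+ i = 1 :> rat by rewrite -expr2 sqrr_sign.
  move: (4 ^+ _) h4 (fact_neq0 i) (i.+1%:R) hi ((-1) ^+ i) s ('C(_, _)%:R).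
  move=> f h4 hf k hk s hs c.
  (* One sign $s$ comes from [wt] and one from the product of the $-i^2$; the intermediate form
     displays $s^2$ so that it can be replaced by 1. *)
  transitivity (- (s * s) * c * (p%:R * t) * (p%:R * t + k) / (f * k ^+ 2)).
    by rewrite hs; field; rewrite h4 hk.
  by field; rewrite h4 hk hf.
apply: pcongD; first by apply: pcong_refl; pint.
apply: pcong_sum => i _; rewrite quadprod_sq.
apply: pcongMl; first by apply: wt_pint; have := ltn_ord i; have := prime_gt0 hp; lia.
have -> : p%:R * t * (p%:R * t + i.+1%:R) = p%:R ^+ 1 * (t * (p%:R * t + i.+1%:R)).
  by rewrite expr1 mulrA.
rewrite -mulrA; apply: (@pcong_shift 1 2).
apply: pcongMl; first by pint.
apply: pcong_prod => j _; apply: (pcong_eq (z := t ^+ 2)); try by pint.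
ring.
Qed.

(** Interpolation at $t=\pm1$: from $u\equiv1-X-Y$ and $v\equiv1+X-Y$ follow $X\equiv(v-u)/2$ and
    $Y\equiv1-(u+v)/2$, as 2 is a unit. *)
Lemma bsum_solve u v :
  pcong p 3 (Ssum p p%:R) u -> pcong p 3 (Ssum p (- p%:R)) v ->
  forall t, t \in pint p ->
  pcong p 3 (Ssum p (p%:R * t))
    (1 - t * ((v - u) / 2) - t ^+ 2 * (1 - (u + v) / 2)).
Proof.
move=> hu hv t ht; have hX := bsum_pint 1; have hY := bsum_pint 2; have h2 := punit2.
have := Ssum_mulp (rpred1 _); rewrite mulr1 => /(pcong_trans (pcong_sym hu)) {}hu.
have := Ssum_mulp (pintN (rpred1 _)).
rewrite mulrN1 => /(pcong_trans (pcong_sym hv)) {}hv.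
apply: (pcong_trans (Ssum_mulp ht)); apply: pcong_sym.
apply: pcongB.
  apply: pcongB; first by apply: pcong_refl; pint.
  apply: pcongMl => //.
  have := pcongMl (punitV_pint punit2) (pcongB hv hu).
  rewrite mulrC => /pcong_trans; apply.
  rewrite [X in pcong _ _ X _](_ : _ = p%:R * bsum 1); last by field.
  by apply: pcong_refl; pint.
apply: pcongMl; first by pint.
rewrite [X in pcong _ _ _ X](_ : _ = 1 - (1 - p%:R ^+ 2 * bsum 2)); last by ring.
apply: pcongB; first by apply: pcong_refl; pint.
have := pcongMl (punitV_pint punit2) (pcongD hu hv).
rewrite mulrC => /pcong_trans; apply.
rewrite [X in pcong _ _ X _](_ : _ = 1 - p%:R ^+ 2 * bsum 2); last by field.
by apply: pcong_refl; pint.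
Qed.

(** * Wolstenholme and Morley congruences *)

Lemma p_half : p = (2 * p./2).+1.
Proof. by rewrite -[in LHS](odd_double_half p) hodd -mul2n. Qed.

Lemma natr_p : p%:R = 2 * (p./2)%:R + 1 :> rat.
Proof. by rewrite {1}p_half -natr1 natrM. Qed.

Lemma harm_pint e n : (n < p)%N -> harm e n \in pint p.
Proof.
move=> hn; rewrite harm_ord rpred_sum // => i _; apply: punitV_pint.
by apply: punitX; apply: punit_small; have := ltn_ord i; lia.
Qed.

Lemma pcong_subp x : x \in pint p -> pcong p 1 (p%:R - x) (- x).
Proof.
by move=> hx; apply: (pcong_eq (z := 1)); rewrite ?rpredN ?rpred1 //; ring.
Qed.

Lemma pcong_subp_sqrV x : x \in punit -> pcong p 1 ((p%:R - x) ^+ 2)^-1 (x ^+ 2)^-1.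
Proof.
move=> hx; have h := pcongX 2 (pcong_subp (punit_pint hx)).
rewrite sqrrN in h; have hx2 := punitX 2 hx.
by apply: pcongV => //; apply: punit_cong h hx2.
Qed.

Lemma half_punit i : (i < p./2)%N -> i.+1%:R \in punit.
Proof. by move=> hi; apply: punit_small; have := p_half; lia. Qed.

Lemma harm2_full : pcong p 1 (harm 2 p.-1) (2 * harm 2 p./2).
Proof.
have -> : (p.-1 = 2 * p./2)%N by rewrite {1}p_half.
have hH : harm 2 p./2 \in pint p by apply: harm_pint; have := p_half; lia.
rewrite harm_cat (_ : 2 * harm 2 _ = harm 2 p./2 + harm 2 p./2); last by ring.
apply: pcongD; first exact: pcong_refl.
rewrite [X in pcong _ _ _ X]harm_ord; apply: pcong_sum => i _.
rewrite (_ : 2 * _ - _ = p%:R - i.+1%:R); last by rewrite natr_p -natr1; ring.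
exact: pcong_subp_sqrV (half_punit (ltn_ord i)).
Qed.

(** Let $H=H^{(2)}_{(p-1)/2}$. Reflecting $k\mapsto p-k$ gives $H^{(2)}_{p-1}\equiv2H$, while
    splitting into odd and even $k$ gives $H/4+H/4$. Hence $\frac32H\equiv0$. *)
Lemma harm2_half : (3 < p)%N -> pcong p 1 (harm 2 p./2) 0.
Proof.
move=> p3; have hH : harm 2 p./2 \in pint p by apply: harm_pint; have := p_half; lia.
have h1 : pcong p 1 (harm 2 p.-1)
    ((2 ^+ 2)^-1 * harm 2 p./2 + (2 ^+ 2)^-1 * harm 2 p./2).
  have -> : (p.-1 = 2 * p./2)%N by rewrite {1}p_half.
  have h4 : (2 ^+ 2)^-1 \in pint p by apply: punitV_pint; apply: punitX punit2.
  rewrite harm_double; apply: pcongD; last by apply: pcong_refl; pint.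
  rewrite odd_sum_rev -natr_p harm_ord mulr_sumr; apply: pcong_sum => i _.
  rewrite -invfM -exprMn; apply: pcong_subp_sqrV; apply: punitM punit2 _.
  exact: half_punit.
(* The inverse of $2-\frac12$; here $p>3$ enters. *)
have hu : 2 / 3 \in pint p.
  apply: rpredM; first by pint.
  by apply: punitV_pint; apply: (@punit_small 3); rewrite p3.
have := pcongMl hu (pcongB (pcong_trans (pcong_sym harm2_full) h1)
  (pcong_refl 1 (pcong_r h1))).
by rewrite subrr mulr0; congr pcong; field.
Qed.

Lemma harm2_pred : (3 < p)%N -> pcong p 1 (harm 2 p.-1) 0.
Proof.
move=> p3; apply: (pcong_trans harm2_full).
by rewrite -(mulr0 2); apply: pcongMl (harm2_half p3); apply: rpred_nat.
Qed.

(** Pairing $k$ with $p-k$ gives $\frac1k+\frac1{p-k}=\frac p{k(p-k)}$. The factor $p$ reduces the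
    claim to $H^{(2)}_{p-1}\equiv0$ modulo $p$. *)
Lemma harm1_pred : (3 < p)%N -> pcong p 2 (harm 1 p.-1) 0.
Proof.
move=> p3; have hp0 := prime_gt0 hp.
have h : pcong p 2 (2 * harm 1 p.-1) (p%:R ^+ 1 * (- harm 2 p.-1)).
  have -> : 2 * harm 1 p.-1 =
      p%:R ^+ 1 * \sum_(i < p.-1) ((p%:R - i.+1%:R) * i.+1%:R)^-1.
    rewrite (_ : 2 * harm 1 _ = harm 1 p.-1 + harm 1 p.-1); last by ring.
    rewrite {1}harm_rev harm_ord -big_split mulr_sumr /=.
    apply: eq_bigr => i _; rewrite prednK //.
    have h1 : i.+1%:R != 0 :> rat by rewrite pnatr_eq0.
    have h2 : p%:R - i.+1%:R != 0 :> rat.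
      rewrite subr_eq0 eqr_nat; have := ltn_ord i; lia.
    by move: h1 h2; move: (i.+1%:R) => x h1 h2; field; rewrite h1 h2.
  apply: (@pcong_shift 1 1); rewrite harm_ord -sumrN; apply: pcong_sum => i _.
  have hi := succ_punit (ltn_ord i).
  have hc := pcong_subp (punit_pint hi).
  rewrite -invrN expr2 -mulNr; apply: pcongV.
  - by apply: punitM => //; apply: punit_cong hc (punitN hi).
  - by apply: punitM => //; apply: punitN.
  - by apply: pcongM => //; apply: pcong_refl; apply: punit_pint.
have h0 : pcong p 2 (p%:R ^+ 1 * (- harm 2 p.-1)) (p%:R ^+ 1 * (- 0)).
  by apply: (@pcong_shift 1 1); apply: pcongN; apply: harm2_pred.
have := pcongMl (punitV_pint punit2) (pcong_trans h h0).
by rewrite oppr0 !mulr0; congr pcong; field.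
Qed.

Lemma central_bin_p : ('C(2 * p, p))%:R =
  2 * \prod_(i < p.-1) (1 + p%:R * (i.+1%:R)^-1) :> rat.
Proof. by have := central_bin_succ p.-1; rewrite prednK ?prime_gt0. Qed.

Lemma prod_lin_mod1 n (c : nat -> rat) : (forall i, (i < n)%N -> c i \in pint p) ->
  pcong p 1 (\prod_(i < n) (1 + p%:R * c i)) 1.
Proof.
move=> hc; rewrite [X in pcong _ _ _ X](_ : 1 = \prod_(i < n) 1);
  last by rewrite big1_eq.
by apply: pcong_prod => i _; apply: (pcong_eq (z := c i)); rewrite ?rpred1 ?hc.
Qed.

Lemma central_bin_p_mod1 : pcong p 1 ('C(2 * p, p))%:R 2.
Proof.
rewrite central_bin_p -[X in pcong _ _ _ X]mulr1; apply: pcongMl; first by pint.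
by apply: (@prod_lin_mod1 _ (fun i => (i.+1%:R)^-1)) => i /succ_punit/punitV_pint.
Qed.

(** The product of the $1+p/k$ is [pexp] of $H_{p-1}$ and $-H^{(2)}_{p-1}$, which vanish to the
    orders that [pexp_cong] requires. *)
Lemma wolstenholme : (3 < p)%N -> pcong p 3 ('C(2 * p, p))%:R 2.
Proof.
move=> p3; rewrite central_bin_p -[X in pcong _ _ _ X]mulr1.
apply: pcongMl; first by pint.
have h := @pexp_prod p.-1 (fun i => (i.+1%:R)^-1)
  (fun i hi => punitV_pint (succ_punit hi)).
apply: (pcong_trans h); rewrite -[X in pcong _ _ _ X]pexp0; apply: pexp_cong.
  rewrite (eq_bigr (fun i : 'I_p.-1 => (i.+1%:R ^+ 1)^-1)) -?harm_ord ?harm1_pred //.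
rewrite -oppr0; apply: pcongN.
rewrite (eq_bigr (fun i : 'I_p.-1 => (i.+1%:R ^+ 2)^-1)) -?harm_ord ?harm2_pred //.
by move=> i _; rewrite exprVn.
Qed.

Local Notation binprod := (\prod_(i < p./2) (1 + p%:R * (- (i.+1%:R)^-1)) : rat).
Local Notation oddprod := (\prod_(i < p./2) (1 + p%:R * (- (2 * i.+1%:R)^-1)) : rat).

Lemma central_bin_half : ('C(2 * p./2, p./2))%:R = (- 1) ^+ p./2 * binprod :> rat.
Proof. by rewrite central_bin_sign addn1 -p_half. Qed.

Lemma oddquot_half : oddquot p./2 = (- 1) ^+ p./2 * oddprod.
Proof.
rewrite /oddquot prodf_div odd_prod_rev -prodf_div -natr_p -prod_scale.
apply: eq_bigr => i _; have hi : i.+1%:R != 0 :> rat by rewrite pnatr_eq0.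
by move: (i.+1%:R) hi => x hi; field; rewrite hi.
Qed.

Lemma pow2_pred : 2 ^+ p.-1 = 4 ^+ p./2 :> rat.
Proof.
have -> : (p.-1 = 2 * p./2)%N by rewrite {1}p_half.
by rewrite exprM; congr (_ ^+ _); ring.
Qed.

Lemma binprod_pow2 : binprod = 2 ^+ p.-1 * oddprod.
Proof.
have s : (-1) ^+ p./2 != 0 :> rat by rewrite signr_eq0.
apply: (mulfI s); rewrite -central_bin_half central_bin_oddquot oddquot_half pow2_pred.
by rewrite mulrCA.
Qed.

Lemma oddprod_punit : oddprod \in punit.
Proof.
apply: punit_cong punit1; apply: prod_lin_mod1 (fun i => - (2 * i.+1%:R)^-1) _.
by move=> i hi; apply: pintN; apply: punitV_pint; apply: punitM punit2 (half_punit hi).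
Qed.

(** Fermat's little theorem for base 2, read off from [binprod_pow2]: both products there are
    congruent to 1. *)
Lemma qp2_pint : qp2 p \in pint p.
Proof.
have h1 : pcong p 1 binprod 1.
  apply: (@prod_lin_mod1 _ (fun i => - (i.+1%:R)^-1)) => i hi.
  by apply: pintN; apply: punitV_pint; apply: half_punit.
have h2 : pcong p 1 oddprod 1.
  apply: (@prod_lin_mod1 _ (fun i => - (2 * i.+1%:R)^-1)) => i hi.
  by apply: pintN; apply: punitV_pint; apply: punitM punit2 (half_punit hi).
have h4 : 2 ^+ p.-1 \in pint p by pint.
have h := pcong_trans (pcong_sym (pcongMl h4 h2)) _.
move: h1; rewrite binprod_pow2 => /h; rewrite mulr1 => /and3P[_ _].
by rewrite expn1.
Qed.

Lemma pow2E : 2 ^+ p.-1 = 1 + p%:R * qp2 p.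
Proof. by rewrite /qp2; field; rewrite p_neq0. Qed.

(* With H = H_((p-1)/2), binprod = exp(-p H) and oddprod = exp(-p H / 2) modulo
   p^3, so binprod = oddprod^2; with binprod_pow2 this gives oddprod = 2^(p-1). *)
Lemma morley : (3 < p)%N -> pcong p 3 oddprod (2 ^+ p.-1).
Proof.
move=> p3; have hH : harm 1 p./2 \in pint p by apply: harm_pint; have := p_half; lia.
have hH2 := harm2_half p3; have u2 := punitV_pint punit2.
have h1 : pcong p 3 binprod (pexp (- harm 1 p./2) 0).
  have h := @pexp_prod p./2 (fun i => - (i.+1%:R)^-1)
    (fun i hi => pintN (punitV_pint (half_punit hi))).
  apply: (pcong_trans h); apply: pexp_cong.
    rewrite sumrN (eq_bigr (fun i : 'I_p./2 => (i.+1%:R ^+ 1)^-1)); last first.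
      by move=> i _; rewrite expr1.
    by rewrite -harm_ord; apply: pcong_refl; pint.
  rewrite -oppr0; apply: pcongN.
  rewrite (eq_bigr (fun i : 'I_p./2 => (i.+1%:R ^+ 2)^-1)) -?harm_ord //.
  by move=> i _; rewrite sqrrN exprVn.
have h2 : pcong p 3 oddprod (pexp (- (2^-1 * harm 1 p./2)) 0).
  have h := @pexp_prod p./2 (fun i => - (2 * i.+1%:R)^-1)
    (fun i hi => pintN (punitV_pint (punitM punit2 (half_punit hi)))).
  apply: (pcong_trans h); apply: pexp_cong.
    rewrite sumrN (eq_bigr (fun i : 'I_p./2 => 2^-1 * (i.+1%:R ^+ 1)^-1)); last first.
      by move=> i _; rewrite invfM expr1.
    by rewrite -mulr_sumr -harm_ord; apply: pcong_refl; pint.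
  rewrite -oppr0; apply: pcongN.
  rewrite (eq_bigr (fun i : 'I_p./2 => 2^-1 ^+ 2 * (i.+1%:R ^+ 2)^-1)); last first.
    by move=> i _; rewrite sqrrN invfM exprMn !exprVn.
  rewrite -mulr_sumr -harm_ord -(mulr0 (2^-1 ^+ 2)).
  exact: pcongMl (rpredX 2 u2) hH2.
have h3 : pcong p 3 (oddprod * oddprod) binprod.
  apply: (pcong_trans (pcongM h2 h2)); apply: pcong_trans (pcong_sym h1).
  apply: pcong_trans (pexpM _ _ _ _) _; try by pint.
  rewrite addr0 (_ : _ + _ = - harm 1 p./2); last by field.
  by apply: pcong_refl; apply: pexp_pint; pint.
have := pcongMl (punitV_pint oddprod_punit) h3.
have u0 := punit_neq0 oddprod_punit.
by rewrite binprod_pow2 mulKf // mulrCA mulVf ?mulr1.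
Qed.

(** * The values at $0$, $-p$ and $p$ *)

Lemma Ssum_0 : pcong p 3 (Ssum p 0) 1.
Proof.
by have := Ssum_mulp (rpred0 _); rewrite mulr0 expr0n /= !mul0r !subr0.
Qed.

(** The symmetry replaces $-p$ by $p-1$, which is even and descends to 0. The descent product is
    [oddquot p./2], evaluated by [morley]. *)
Lemma Ssum_oppp : (3 < p)%N -> pcong p 3 (Ssum p (- p%:R)) ((2 ^+ p.-1) ^+ 2).
Proof.
move=> p3; rewrite (_ : - p%:R = - 1 - (p.-1)%:R); last first.
  by rewrite -[in LHS](prednK (prime_gt0 hp)) -natr1; ring.
rewrite Ssum_sym.
have hr : (2 * p./2 <= p.-1 < p)%N by have := p_half; lia.
have hc : pcong p 1 (p.-1)%:R (p.-1)%:R by apply: pcong_refl; pint.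
apply: (pcong_trans (Ssum_descent hc hr)).
have -> : (p.-1 = 2 * p./2)%N by rewrite {1}p_half.
rewrite subrr [X in pcong _ _ _ X](_ : _ = (2 ^+ p.-1) ^+ 2 * 1); last first.
  by rewrite mulr1 {2}p_half.
apply: pcongM; last exact: Ssum_0.
rewrite (_ : \prod_(i < p./2) _ = (-1) ^+ p./2 * oddprod).
  rewrite exprMn sqrr_sign mul1r; apply: pcongX; exact: morley.
rewrite -oddquot_half [LHS](@big_rev_ord _ _ p./2
  (fun i => ((2 * p./2)%:R - 1 - (2 * i)%:R) / ((2 * p./2)%:R - (2 * i)%:R))).
apply: eq_bigr => i _; rewrite !natrM natrB // -natr1.
by congr (_ / _); ring.
Qed.

(** At every odd $a$ with $0<a\le n$ the factor of [shiftprod n a] with index $a-1$ is zero, so the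
    recurrence is homogeneous; at $a=1$ the coefficient $(a-1)^2$ vanishes too. *)
Lemma Ssum_odd0 n j : (2 * j + 1 <= n)%N -> Ssum n.+1 (2 * j + 1)%:R = 0.
Proof.
elim: j => [|j IH] hj.
  have := @Ssum_rec n 1; rewrite (_ : shiftprod n 1 = 0).
    by rewrite subrr expr1n expr0n mul1r mul0r mulr0 subr0.
  by rewrite /shiftprod (bigD1 (Ordinal hj)) //= subrr subr0 mulr0 mul0r.
have := @Ssum_rec n (2 * j.+1 + 1)%:R.
rewrite (_ : (2 * j.+1 + 1)%:R - 2 = (2 * j + 1)%:R); last first.
  by rewrite mulnS !natrD; ring.
rewrite IH; last by lia.
rewrite (_ : shiftprod n _ = 0).
  rewrite !mulr0 subrr => /eqP; rewrite mulf_eq0 expf_eq0 /= pnatr_eq0 addn1 /=.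
  by move/eqP.
have hi : (2 * j + 2 < n)%N by lia.
rewrite /shiftprod (bigD1 (Ordinal hi)) //= (_ : _ - 1 - _ = 0) ?mulr0 ?mul0r //.
by rewrite mulnS !natrD; ring.
Qed.

(** Because $S_{p+1}(p)=0$, the sum $S_p(p)$ is minus the term of index $p$, namely
    $\binom{2p}p^2/4^p$, and [wolstenholme] turns it into $4/4^p$. *)
Lemma Ssum_p : (3 < p)%N -> pcong p 3 (Ssum p p%:R) ((2 ^+ p.-1) ^+ 2)^-1.
Proof.
move=> p3; have h0 : Ssum p.+1 p%:R = 0.
  by have := @Ssum_odd0 p p./2; rewrite addn1 -p_half; apply.
have hf := fact_neq0 p; have h4 : 4 ^+ p != 0 :> rat by rewrite expf_neq0.
have hq : quadprod p p%:R = (p`!)%:R * ((p`!)%:R * ('C(2 * p, p))%:R).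
  rewrite /quadprod big_split /=; congr (_ * _).
    rewrite natr_fact (@big_rev_ord _ _ p (fun i => i.+1%:R)).
    by apply: eq_bigr => i _; rewrite -natr1 natrB // -natr1; ring.
  rewrite central_bin mul2n -addnn natr_factD.
  rewrite (eq_bigr (fun i : 'I_p => p%:R + i.+1%:R)); last first.
    by move=> i _; rewrite -natr1; ring.
  by field; rewrite hf.
have -> : Ssum p p%:R = ('C(2 * p, p))%:R ^+ 2 / 4 ^+ p.
  move: h0; rewrite !SsumE big_nat_recr //= hq /wt -signr_odd hodd expr1.
  move/eqP; rewrite addr_eq0 => /eqP ->.
  by field; rewrite hf h4.
have hw := pcongX 2 (wolstenholme p3).
have hv : (4 ^+ p)^-1 \in pint p by apply: punitV_pint; apply: punitX punit4.
have := pcongMl hv hw; rewrite mulrC; congr pcong.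
rewrite -{1}(prednK (prime_gt0 hp)) exprS exprAC (_ : 2 ^+ 2 = 4); last by ring.
by field; rewrite expf_neq0.
Qed.

Lemma Ssum_mulp_closed t : (3 < p)%N -> t \in pint p ->
  pcong p 3 (Ssum p (p%:R * t))
    (1 - 2 * t * (2 ^+ p.-1 - 1) + t * (2 * t + 1) * (2 ^+ p.-1 - 1) ^+ 2).
Proof.
move=> p3 ht; have hq := qp2_pint; have u2 := punit2.
have hv := Ssum_oppp p3; have hu := Ssum_p p3.
(* With $x=2^{p-1}-1=pq$, this is the expansion of $(1+x)^{-2}$; the error in
   $(1+x)^2(1-2x+3x^2)=1+4x^3+3x^4$ gives the witness below. *)
have hi : pcong p 3 ((2 ^+ p.-1) ^+ 2)^-1
    (1 - 2 * (p%:R * qp2 p) + 3 * (p%:R * qp2 p) ^+ 2).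
  have hp2 := punitX 2 (punitX p.-1 punit2).
  have h : pcong p 3 ((2 ^+ p.-1) ^+ 2 *
      (1 - 2 * (p%:R * qp2 p) + 3 * (p%:R * qp2 p) ^+ 2)) 1.
    rewrite pow2E; apply: (pcong_eq (z := qp2 p ^+ 3 * (4 + 3 * p%:R * qp2 p))).
    - exact: rpred1.
    - by pint.
    - by ring.
  have := pcongMl (punitV_pint hp2) (pcong_sym h).
  by rewrite mulr1 mulKf // punit_neq0.
apply: (pcong_trans (bsum_solve (pcong_trans hu hi) hv ht)).
rewrite pow2E [X in pcong _ _ X _](_ : _ = 1 - 2 * t * (1 + p%:R * qp2 p - 1) +
  t * (2 * t + 1) * (1 + p%:R * qp2 p - 1) ^+ 2); last by field.
by apply: pcong_refl; pint.
Qed.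

(** * Even and odd residues *)

Lemma pexp_mul u v x1 y1 x2 y2 : x1 \in pint p -> y1 \in pint p ->
  x2 \in pint p -> y2 \in pint p -> pcong p 3 u (pexp x1 y1) ->
  pcong p 3 v (pexp x2 y2) -> pcong p 3 (u * v) (pexp (x1 + x2) (y1 + y2)).
Proof.
move=> hx1 hy1 hx2 hy2 hu hv; apply: pcong_trans (pcongM hu hv) _.
exact: pexpM.
Qed.

Lemma pexp_inv u x y : x \in pint p -> y \in pint p ->
  pcong p 3 u (pexp x y) -> pcong p 3 u^-1 (pexp (- x) (- y)).
Proof.
move=> hx hy hu; have he := punit_pexp hx hy.
apply: pcong_trans (pexpV hx hy); apply: pcongV => //.
by apply: punit_cong he; apply: pcong_le hu.
Qed.

Lemma odd_punit n i : (2 * n < p)%N -> (i < n)%N -> 2 * i%:R + 1 \in punit.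
Proof.
by move=> hn hi; rewrite -natrM natr1; apply: punit_small; lia.
Qed.

Lemma even_punit n i : (2 * n < p)%N -> (i < n)%N -> 2 * i.+1%:R \in punit.
Proof.
by move=> hn hi; rewrite -natrM; apply: punit_small; lia.
Qed.

Lemma oddquot_punit n : (2 * n < p)%N -> oddquot n \in punit.
Proof.
move=> hn; apply: punit_prod => i _.
by apply: punitM (odd_punit hn (ltn_ord i)) (punitV (even_punit hn (ltn_ord i))).
Qed.

Lemma binq_half_mod1 n : (2 * n < p)%N ->
  pcong p 1 (binq ((p%:R - 1) / 2) n ^+ 2) (oddquot n ^+ 2).
Proof.
move=> hn; rewrite binq_half exprMn sqrr_sign (mul1r (_ ^+ 2)).
rewrite -[X in pcong _ _ _ (X ^+ 2)]mulr1; apply: pcongX.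
apply: pcongMl; first exact: punit_pint (oddquot_punit hn).
apply: (@prod_lin_mod1 _ (fun i => - (2 * i%:R + 1)^-1)) => i hi.
by apply: pintN; apply: punitV_pint; apply: odd_punit hn hi.
Qed.

Lemma even_case t n : t \in pint p -> (0 < n)%N -> (2 * n < p.-1)%N ->
  pcong p 3 (Ssum p ((2 * n)%:R + p%:R * t))
    ((\prod_(i < n) ((2 * i%:R + 1 + p%:R * t) / (2 * i.+1%:R + p%:R * t))) ^+ 2
     * (1 - 2 * t * (2 ^+ p.-1 - 1) + t * (2 * t + 1) * (2 ^+ p.-1 - 1) ^+ 2)).
Proof.
move=> ht n0 hn.
have ha : pcong p 1 ((2 * n)%:R + p%:R * t) (2 * n)%:R.
  by apply: (pcong_eq (z := t)) => //; pint.
have hr : (2 * n <= 2 * n < p)%N by lia.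
apply: (pcong_trans (Ssum_descent ha hr)).
(* The bounds $0<2n<p-1$ exclude $p=3$. *)
have p3 : (3 < p)%N by lia.
have h := Ssum_mulp_closed p3 ht.
rewrite [X in Ssum p X](_ : _ = p%:R * t); last by ring.
have := @descent_prod_rev n 0 (p%:R * t).
under eq_bigr do rewrite addr0.
under [in RHS]eq_bigr do rewrite !addr0.
move=> ->; apply: pcongMl => //; apply: rpredX; apply: rpred_prod => i _.
have hp' : p%:R * t \in pint p by pint.
have hc x : x \in punit -> x + p%:R * t \in punit.
  move=> hx; apply: (punit_cong _ hx); apply: (pcong_eq (z := t)) => //.
  exact: punit_pint.
have hn' : (2 * n < p)%N by lia.
apply: punit_pint; apply: punitM; first exact: hc (odd_punit hn' (ltn_ord i)).
exact: punitV (hc _ (even_punit hn' (ltn_ord i))).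
Qed.

(** After the common factor [oddquot n ^+ 2] is removed, both sides are products of [pexp] values,
    and the congruence becomes an equality of their summed arguments. *)
Lemma even_case_expand t n L : t \in pint p -> (2 * n < p)%N ->
  L = (2 * t + 2) * harm 1 (2 * n) - (2 * t + 1) * harm 1 n - 2 * t * qp2 p ->
  pcong p 3
    ((\prod_(i < n) ((2 * i%:R + 1 + p%:R * t) / (2 * i.+1%:R + p%:R * t))) ^+ 2
     * (1 - 2 * t * (2 ^+ p.-1 - 1) + t * (2 * t + 1) * (2 ^+ p.-1 - 1) ^+ 2))
    (binq ((p%:R - 1) / 2) n ^+ 2 * (1 + p%:R * L
       + p%:R ^+ 2 / 2 * (2 * t * qp2 p ^+ 2 + L ^+ 2
         + 1 / 2 * (2 * t ^+ 2 - 1) * harm 2 n + 2 * (1 - t ^+ 2) * harm 2 (2 * n)))).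
Proof.
move=> ht hn defL; have hq := qp2_pint.
(* Sums over the odd and the even numbers up to $2n$. Both $H_n^{(e)}$ and $H_{2n}^{(e)}$ are
   combinations of them, and every product below has one of them as its logarithm. *)
pose h e := \sum_(i < n) ((2 * i%:R + 1) ^+ e)^-1 : rat.
pose g e := \sum_(i < n) ((2 * i.+1%:R) ^+ e)^-1 : rat.
have hh e : h e \in pint p.
  rewrite rpred_sum // => i _; apply: punitV_pint; apply: punitX.
  exact: odd_punit hn (ltn_ord i).
have hg e : g e \in pint p.
  rewrite rpred_sum // => i _; apply: punitV_pint; apply: punitX.
  exact: even_punit hn (ltn_ord i).
have Hg e : harm e n = 2 ^+ e * g e.
  rewrite harm_ord /g mulr_sumr; apply: eq_bigr => i _.
  by rewrite exprMn invfM mulVKf // expf_neq0.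
have Hh e : harm e (2 * n) = h e + g e.
  by rewrite harm_double Hg mulKf // expf_neq0.
have d1 : pcong p 3 (\prod_(i < n) (1 + p%:R * (t * (2 * i%:R + 1)^-1)))
    (pexp (t * h 1) (- (t ^+ 2 * h 2))).
  have := @pexp_prod n (fun i => t * (2 * i%:R + 1)^-1)
    (fun i hi => rpredM ht (punitV_pint (odd_punit hn hi))).
  rewrite -mulr_sumr; under [X in pexp _ (- X)]eq_bigr do rewrite exprMn exprVn.
  by rewrite -mulr_sumr.
have d2 : pcong p 3 (\prod_(i < n) (1 + p%:R * (t * (2 * i.+1%:R)^-1)))
    (pexp (t * g 1) (- (t ^+ 2 * g 2))).
  have := @pexp_prod n (fun i => t * (2 * i.+1%:R)^-1)
    (fun i hi => rpredM ht (punitV_pint (even_punit hn hi))).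
  rewrite -mulr_sumr; under [X in pexp _ (- X)]eq_bigr do rewrite exprMn exprVn.
  by rewrite -mulr_sumr.
have d3 : pcong p 3 (\prod_(i < n) (1 + p%:R * - (2 * i%:R + 1)^-1))
    (pexp (- h 1) (- h 2)).
  have := @pexp_prod n (fun i => - (2 * i%:R + 1)^-1)
    (fun i hi => pintN (punitV_pint (odd_punit hn hi))).
  by rewrite sumrN; under [X in pexp _ (- X)]eq_bigr do rewrite sqrrN exprVn.
rewrite binq_half.
have -> : \prod_(i < n) ((2 * i%:R + 1 + p%:R * t) / (2 * i.+1%:R + p%:R * t)) =
  oddquot n * ((\prod_(i < n) (1 + p%:R * (t * (2 * i%:R + 1)^-1))) *
    (\prod_(i < n) (1 + p%:R * (t * (2 * i.+1%:R)^-1)))^-1).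
  rewrite -prodf_div -big_split /=; apply: eq_bigr => i _.
  move: (odd_neq0 i) (even_neq0 i); move: (2 * i%:R + 1) (2 * i.+1%:R) => x y hx hy.
  by rewrite mulf_div; congr (_ / _); field.
move: d1 d2 d3.
move: (\prod_(i < n) _) (\prod_(i < n) _) (\prod_(i < n) _) => D3 D2 D1 d1 d2 d3.
rewrite [(_ * (oddquot n * D3)) ^+ 2]exprMn sqrr_sign (mul1r (_ ^+ 2)).
have sq (w x z : rat) : (w * x) ^+ 2 * z = w ^+ 2 * (x ^+ 2 * z) by ring.
rewrite !(sq (oddquot n)); apply: pcongMl.
  by apply: rpredX; apply: punit_pint; apply: oddquot_punit.
have -> : 1 - 2 * t * (2 ^+ p.-1 - 1) + t * (2 * t + 1) * (2 ^+ p.-1 - 1) ^+ 2 =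
    pexp (- (2 * t * qp2 p)) (2 * t * qp2 p ^+ 2).
  by rewrite pow2E /pexp; field.
(* The second [pexp] argument of the right-hand bracket:
   $\frac12(2t^2-1)H_n^{(2)}+2(1-t^2)H_{2n}^{(2)}$ rewritten with $H_n^{(2)}=4g_2$ and
   $H_{2n}^{(2)}=h_2+g_2$. *)
pose M := 2 * t * qp2 p ^+ 2 + 2 * (1 - t ^+ 2) * h 2 + 2 * t ^+ 2 * g 2.
have eL : L = (2 * t + 2) * h 1 - 2 * t * g 1 - 2 * t * qp2 p.
  by rewrite defL Hh Hg; ring.
set B := (X in pcong _ _ _ (_ * X)).
have -> : B = pexp L M by rewrite /B /M /pexp Hh Hg; field.
have hL : L \in pint p by rewrite eL; pint.
have hM : M \in pint p by rewrite /M; pint.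
have h1 : t * h 1 \in pint p by pint.
have h2 : - (t ^+ 2 * h 2) \in pint p by pint.
have g1 : t * g 1 \in pint p by pint.
have g2 : - (t ^+ 2 * g 2) \in pint p by pint.
have k1 : - h 1 \in pint p by pint.
have k2 : - h 2 \in pint p by pint.
have q1 : - (2 * t * qp2 p) \in pint p by pint.
have q2 : 2 * t * qp2 p ^+ 2 \in pint p by pint.
have c1 := pexp_mul h1 h2 (pintN g1) (pintN g2) d1 (pexp_inv g1 g2 d2).
have x1 := rpredD h1 (pintN g1); have y1 := rpredD h2 (pintN g2).
have c2 := pexp_mul x1 y1 x1 y1 c1 c1.
have {}c2 := pexp_mul (rpredD x1 x1) (rpredD y1 y1) q1 q2 c2
  (pcong_refl 3 (pexp_pint q1 q2)).
have c3 := pexp_mul k1 k2 k1 k2 d3 d3.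
have {}c3 := pexp_mul (rpredD k1 k1) (rpredD k2 k2) hL hM c3
  (pcong_refl 3 (pexp_pint hL hM)).
rewrite [(D1 / D2) ^+ 2]expr2 [D3 ^+ 2]expr2.
apply: (pcong_trans c2); apply: pcong_sym; apply: (pcong_trans c3).
rewrite (_ : _ + L =
  t * h 1 + - (t * g 1) + (t * h 1 + - (t * g 1)) + - (2 * t * qp2 p)).
  rewrite (_ : _ + M = - (t ^+ 2 * h 2) + - - (t ^+ 2 * g 2) +
    (- (t ^+ 2 * h 2) + - - (t ^+ 2 * g 2)) + 2 * t * qp2 p ^+ 2).
    by apply: pcong_refl; apply: pexp_pint; pint.
  by rewrite /M; ring.
by rewrite eL; ring.
Qed.

Lemma pow2_mod1 : pcong p 1 (2 ^+ p.-1) 1.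
Proof.
by rewrite pow2E; apply: (pcong_eq (z := qp2 p)); rewrite ?rpred1 ?qp2_pint.
Qed.

Lemma pow4_mod1 : pcong p 1 (4 ^+ p) 4.
Proof.
rewrite (_ : 4 ^+ p = 4 * (2 ^+ p.-1) ^+ 2); last first.
  rewrite -{1}(prednK (prime_gt0 hp)) exprS exprAC; congr (_ * _ ^+ _); ring.
rewrite -[X in pcong _ _ _ X]mulr1; apply: pcongMl; first by pint.
by rewrite -(expr1n _ 2); apply: pcongX pow2_mod1.
Qed.

Lemma Ssum_mulp_mod1 t : t \in pint p -> pcong p 1 (Ssum p (p%:R * t)) 1.
Proof.
move=> ht; have h1 := bsum_pint 1; have h2 := bsum_pint 2.
apply: (pcong_trans (pcong_le (isT : (1 <= 3)%N) (Ssum_mulp ht))).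
apply: (pcong_eq (z := - (t * bsum 1) - t ^+ 2 * (p%:R * bsum 2))); try by pint.
by ring.
Qed.

(* Modulo p the last product below is (-1)^(p-2) (p-2)! = (p-1)!. *)
Lemma shiftprod_succ_mulp t : t \in pint p ->
  exists2 z, pcong p 1 z (((p.-1)`!)%:R ^+ 2)
    & shiftprod p.-1 (1 + p%:R * t) = p%:R * t * z.
Proof.
move=> ht.
exists (\prod_(i < p.-1) (i.+1%:R + p%:R * t) *
        \prod_(i < p.-2) (p%:R * t - i.+1%:R)); last first.
  rewrite /shiftprod big_split /= mulrCA; congr (_ * _).
    by apply: eq_bigr => i _; rewrite -natr1; ring.
  have -> : p.-1 = p.-2.+1 by have := p_gt2; lia.
  rewrite big_ord_recl /= subr0; congr (_ * _); first by ring.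
  by apply: eq_bigr => i _; rewrite /bump add1n; ring.
rewrite expr2; apply: pcongM.
  rewrite natr_fact; apply: pcong_prod => i _.
  by apply: (pcong_eq (z := t)) => //; pint.
have hs : (-1) ^+ p.-2 = - 1 :> rat.
  have e : p = p.-2.+2 by have := p_gt2; lia.
  by have := hodd; rewrite {1}e /= negbK -signr_odd => ->.
apply: (@pcong_trans _ ((-1) ^+ p.-2 * ((p.-2)`!)%:R)).
  rewrite natr_fact -prod_scale; apply: pcong_prod => i _.
  by apply: (pcong_eq (z := t)) => //; try pint; ring.
rewrite hs (_ : p.-1 = p.-2.+1); last by have := p_gt2; lia.
rewrite factS natrM.
apply: (pcong_eq (z := - ((p.-2)`!)%:R)); try by pint.
rewrite [in RHS](_ : p%:R = p.-2.+1%:R + 1); first by ring.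
by rewrite natr1; congr (_%:R); have := p_gt2; lia.
Qed.

(** Both terms of the recurrence at $a=1+pt$ carry $p^2$: one through $(a-1)^2$, the other through
    $p\cdot p^2w_p\cdot pt$. Modulo $p$ the cofactors are $t^2$ and $t$. *)
Lemma Ssum_succ_mulp t : t \in pint p ->
  pcong p 3 (Ssum p (1 + p%:R * t)) (p%:R ^+ 2 * (t * (t + 1))).
Proof.
move=> ht; have hb : pcong p 1 (1 + p%:R * t) 1.
  by apply: (pcong_eq (z := t)); rewrite ?rpred1.
have hu := punit_cong hb punit1; have hf := punit_pred_fact.
have [z hz ez] := shiftprod_succ_mulp ht.
have h0 : pcong p 1 (Ssum p (1 + p%:R * t - 2)) 1.
  rewrite (_ : _ - 2 = - 1 - p%:R * - t); last by ring.
  by rewrite Ssum_sym; apply: Ssum_mulp_mod1; apply: pintN.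
have := @Ssum_rec p.-1 (1 + p%:R * t); rewrite prednK ?prime_gt0 // ez.
move: hu h0; set b := 1 + p%:R * t; set S := Ssum p (b - 2) => hu h0 E.
(* The cofactor of $p^2t$ in the hypergeometric term. Modulo $p$ it is $2\cdot2\cdot\frac14=1$, by
   $\binom{2p}p\equiv2$, $4^p\equiv4$ and $z\equiv(p-1)!^2$. *)
pose K := 2 * (2 * b - 1) *
  (('C(2 * p, p))%:R * (4 ^+ p)^-1 * ((((p.-1)`!)%:R ^+ 2)^-1 * z)).
have eS : Ssum p b = p%:R ^+ 2 * ((b ^+ 2)^-1 * (t ^+ 2 * S + t * K)).
  have b0 := punit_neq0 hu; apply: (mulfI (expf_neq0 2 b0)); rewrite {}E.
  have hw := wt_p; rewrite -signr_odd hodd expr1 in hw.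
  have -> : 2 * (2 * b - 1) * p%:R ^+ 3 * wt p * (p%:R * t * z) =
     2 * (2 * b - 1) * (p%:R ^+ 2 * wt p) * (p%:R ^+ 2 * t * z) by ring.
  rewrite hw /K (_ : b - 1 = p%:R * t); last by rewrite /b; ring.
  by field; rewrite b0 (punit_neq0 hf) expf_neq0.
have hK : pcong p 1 K 1.
  have hf2 := punitX 2 hf; have h4 := pow4_mod1.
  have u4 : 4 ^+ p \in punit by apply: punitX punit4.
  have h : pcong p 1 K (2 * (2 * 1 - 1) *
      (2 * 4^-1 * ((((p.-1)`!)%:R ^+ 2)^-1 * (((p.-1)`!)%:R ^+ 2)))).
    apply: pcongM; last apply: pcongM; last by apply: pcongMl hz; exact: punitV_pint.
      apply: pcongMl; first by pint.
      by apply: pcongB; [apply: pcongMl => //; pint|apply: pcong_refl; pint].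
    by apply: pcongM central_bin_p_mod1 (pcongV _ punit4 h4).
  rewrite (mulVf (punit_neq0 hf2)) in h.
  by move: h; congr pcong; field.
rewrite {}eS; apply: (@pcong_shift 2 1).
rewrite (_ : t * (t + 1) = 1^-1 * (t ^+ 2 * 1 + t * 1)); last by field.
apply: pcongM; last by apply: pcongD; apply: pcongMl => //; pint.
apply: pcongV; [exact: punitX|exact: punit1|].
by rewrite -[X in pcong _ _ _ X](expr1n _ 2); apply: pcongX.
Qed.

(** Since $S_p(1+pt)$ already carries $p^2$, the descent product is needed only modulo $p$, where
    $pt$ drops out and [oddquot_shift] evaluates it. *)
Lemma odd_case a t m : t \in pint p -> (2 * m + 1 < p)%N ->
  a = (2 * m + 1)%:R + p%:R * t ->
  pcong p 3 (Ssum p a) (p%:R ^+ 2 * (t * (t + 1) * (a ^+ 2)^-1 * (oddquot m ^+ 2)^-1)).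
Proof.
move=> ht hm ea.
have hm' : (2 * m < p)%N by lia.
have hp' : p%:R * t \in pint p by pint.
have ha : pcong p 1 a (2 * m + 1)%:R.
  by rewrite ea; apply: (pcong_eq (z := t)) => //; pint.
have ua : a \in punit by apply: (punit_cong ha); apply: punit_small; lia.
have ha1 : pcong p 1 a (2 * m%:R + 1) by rewrite -natrM natr1 -[X in X%:R]addn1.
have um := oddquot_punit hm'.
have hr : (2 * m <= 2 * m + 1 < p)%N by lia.
have odd1 i : (i <= m)%N -> 2 * i%:R + 1 \in punit.
  by move=> hi; rewrite -natrM natr1; apply: punit_small; lia.
apply: (pcong_trans (Ssum_descent ha hr)).
rewrite (_ : a - (2 * m)%:R = 1 + p%:R * t); last by rewrite ea natrD; ring.
have := @descent_prod_rev m 1 (p%:R * t).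
rewrite (_ : _ + 1 + _ = a) => [->|]; last by rewrite ea natrD.
set P := \prod_(i < m) _.
have hP : pcong p 1 P (a^-1 * (oddquot m)^-1).
  apply: (@pcong_trans _ ((2 * m%:R + 1)^-1 * (oddquot m)^-1)); last first.
    apply: pcongM; last by apply: pcong_refl; exact: punitV_pint.
    by apply: pcongV => //; [exact: odd1|exact: pcong_sym].
  have -> : (2 * m%:R + 1)^-1 * (oddquot m)^-1 =
      \prod_(i < m) ((2 * i.+1%:R) / (2 * i.+1%:R + 1)) :> rat.
    have h1 := odd_neq0 m; have h2 := punit_neq0 um.
    rewrite -invfM; apply: (mulIf (mulf_neq0 h1 h2)).
    by rewrite oddquot_shift mulVf // mulf_neq0.
  apply: pcong_prod => i _.
  have u1 : 2 * i.+1%:R + 1 \in punit by apply: odd1.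
  have c1 : pcong p 1 (2 * i.+1%:R + 1 + p%:R * t) (2 * i.+1%:R + 1).
    by apply: (pcong_eq (z := t)) => //; exact: punit_pint.
  apply: pcongM.
    apply: (pcong_eq (z := t)) => //; first by pint.
    by rewrite -natr1; ring.
  by apply: pcongV => //; apply: punit_cong c1 u1.
have hPp := pcong_l hP.
apply: (pcong_trans (pcongMl (rpredX 2 hPp) (Ssum_succ_mulp ht))).
rewrite mulrCA; apply: (@pcong_shift 2 1).
rewrite mulrC -mulrA; apply: pcongMl; first by pint.
by rewrite -!exprVn -exprMn; apply: pcongX.
Qed.

Lemma odd_case_swap t m a : t \in pint p -> (2 * m < p)%N -> a \in punit ->
  pcong p 3 (p%:R ^+ 2 * (t * (t + 1) * (a ^+ 2)^-1 * (oddquot m ^+ 2)^-1))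
    (p%:R ^+ 2 * (t * (t + 1) * (a ^+ 2)^-1 * (binq ((p%:R - 1) / 2) m ^+ 2)^-1)).
Proof.
move=> ht hm ha; apply: (@pcong_shift 2 1).
have ha2 := punitX 2 ha; have um := punitX 2 (oddquot_punit hm).
have hb := binq_half_mod1 hm.
apply: pcongMl; first by pint.
by apply: pcongV; [|apply: punit_cong hb um|apply: pcong_sym].
Qed.

End OddPrime.

Theorem theorem2p1 (p : nat) (a : rat) (hp : prime p) (hodd : odd p)
    (ha : a \in pint p) (ha0 : ~~ pcong p 1 a 0) (ha1 : ~~ pcong p 1 a (- 1)) :
  let r := pres p a in
  let a' := (a - r%:R) / p%:R in
  (forall n : nat, r = (2 * n)%N ->
    let t : rat := 2 ^+ p.-1 - 1 in
    let L : rat := (2 * a' + 2) * harm 1 (2 * n) - (2 * a' + 1) * harm 1 n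
                   - 2 * a' * qp2 p in
    let A : rat := binq ((a - 1) / 2) n ^+ 2 / binq (a / 2) n ^+ 2
                   * (1 - 2 * a' * t + a' * (2 * a' + 1) * t ^+ 2) in
    let B : rat := binq ((p%:R - 1) / 2) n ^+ 2
                   * (1 + p%:R * L
                      + p%:R ^+ 2 / 2
                        * (2 * a' * qp2 p ^+ 2 + L ^+ 2
                           + 1 / 2 * (2 * a' ^+ 2 - 1) * harm 2 n
                           + 2 * (1 - a' ^+ 2) * harm 2 (2 * n))) in
    pcong p 3 (Ssum p a) A /\ pcong p 3 A B) /\
  (odd r ->
    let A : rat := 4 ^+ r.-1 * a' * (a' + 1) * p%:R ^+ 2
                   / (a ^+ 2 * ('C(r.-1, (r.-1)./2))%:R ^+ 2) in
    let B : rat := a' * (a' + 1) * p%:R ^+ 2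
                   / (a ^+ 2 * binq ((p%:R - 1) / 2) (r.-1)./2 ^+ 2) in
    pcong p 3 (Ssum p a) A /\ pcong p 3 A B).
Proof.
have [] := presP hp ha; move: (pres p a) => r rp har /=.
have hp0 := p_neq0 hp.
set t := (a - r%:R) / p%:R.
have ht : t \in pint p by case/and3P: har => _ _; rewrite expn1.
have ea : a = r%:R + p%:R * t by rewrite /t mulrCA mulfV // mulr1 addrC subrK.
(* The two noncongruences give $0<r<p-1$: hence $n\ge1$ and $2n<p-1$ in the even case. *)
have r0 : (0 < r)%N.
  by rewrite lt0n; apply: contraNneq ha0 => e; rewrite e in har.
have r1 : (r < p.-1)%N.
  have : r != p.-1; last by lia.
  apply: contraNneq ha1 => e; rewrite e in har; apply: (pcong_trans hp har).
  have h1 := punit_pint (punit1 hp).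
  apply: (pcong_eq hp (pintN hp h1) h1).
  by rewrite -[in RHS](prednK (prime_gt0 hp)) -natr1; ring.
split=> [n en|ro].
  have n0 : (0 < n)%N by lia.
  have hn : (2 * n < p.-1)%N by lia.
  have hn' : (2 * n < p)%N by lia.
  have -> : binq ((a - 1) / 2) n ^+ 2 / binq (a / 2) n ^+ 2 =
     (\prod_(i < n) ((2 * i%:R + 1 + p%:R * t) / (2 * i.+1%:R + p%:R * t))) ^+ 2.
    rewrite -expr_div_n binq_ratio ea en; congr (_ ^+ 2).
    have := @descent_prod_rev n 0 (p%:R * t).
    under eq_bigr do rewrite addr0.
    by under [in RHS]eq_bigr do rewrite !addr0.
  rewrite {1}ea en; split; first exact: even_case.
  exact: even_case_expand.
pose m := (r.-1)./2.
have em : r = (2 * m + 1)%N by rewrite /m; lia.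
have hm : (2 * m + 1 < p)%N by lia.
have hm' : (2 * m < p)%N by lia.
have hua : a \in punit p.
  by apply: (punit_cong hp har); apply: (punit_small hp); lia.
have -> : r.-1 = (2 * m)%N by rewrite em addn1.
rewrite mul2n doubleK -mul2n.
have um := punit_neq0 (oddquot_punit hp hodd hm').
have -> : 4 ^+ (2 * m) * t * (t + 1) * p%:R ^+ 2 / (a ^+ 2 * ('C(2 * m, m))%:R ^+ 2) =
    p%:R ^+ 2 * (t * (t + 1) * (a ^+ 2)^-1 * (oddquot m ^+ 2)^-1).
  rewrite central_bin_oddquot exprM exprAC.
  by field; rewrite um (punit_neq0 hua) expf_neq0.
have -> : t * (t + 1) * p%:R ^+ 2 / (a ^+ 2 * binq ((p%:R - 1) / 2) m ^+ 2) =
    p%:R ^+ 2 * (t * (t + 1) * (a ^+ 2)^-1 * (binq ((p%:R - 1) / 2) m ^+ 2)^-1).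
  by rewrite invfM; ring.
split; last exact: odd_case_swap.
by apply: odd_case => //; rewrite -em -ea.
Qed.
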